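(* Using the order $<_1$ on $\mathcal A$, \[ C_\lambda[X(t-1);q,t]=\sum_{\sigma}(-1)^{m(\sigma)}q^{\mathrm{maj}(\sigma)}t^{p(\sigma)+\mathrm{quinv}(\sigma)}x^{|\sigma|}, \] where the sum runs over all super fillings $\sigma$ of $\mathrm{dg}(\lambda)$ in which no attacking pair of cells $u,v$ has $|\sigma(u)|=|\sigma(v)|$. Moreover $C_\lambda[X(t-1);q,t]=\sum_{\mu\le\lambda}c_{\mu\lambda}(q,t)\,m_\mu(X)$ for some $c_{\mu\lambda}(q,t)\in\mathbb Q(q,t)$, where $\le$ is dominance order and $m_\mu$ are monomial symmetric functions.
   Context: Let $\lambda=(\lambda_1\ge\dots\ge\lambda_k>0)$ be a partition; $\mathrm{dg}(\lambda)=\{(r,i):1\le i\le k,1\le r\le\lambda_i\}$, $(r,i)$ being row $r$ from the bottom and column $i$ from the left (columns bottom-justified of heights $\lambda_i$); $\mathrm{leg}((r,i))=\lambda_i-r$. $C_\lambda(X;q,t)=\sum_\sigma q^{\mathrm{maj}(\sigma)}t^{\mathrm{quinv}(\sigma)}x^\sigma$ over fillings $\sigma:\mathrm{dg}(\lambda)\to\mathbb Z_{>0}$ (the special case of the super-filling statistics below with all entries positive); it is a symmetric function, and $f[X(t-1)]$ denotes the plethysm sending power sums $p_m(X)\mapsto(t^m-1)p_m(X)$. Super fillings: $\mathcal A=\{1,\bar1,2,\bar2,\dots\}$ consists of positive letters $i$ and negative letters $\bar i$, with $|i|=|\bar i|=i$. The total order $<_1$ on $\mathcal A\cup\{0\}$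 is $0<1<\bar1<2<\bar2<\cdots$ (and $<_2$ is $0<1<2<3<\cdots<\bar3<\bar2<\bar1$). For the chosen order, $I(a,b)=1$ if $a>b$ or $a=b$ is negative, and $I(a,b)=0$ if $a<b$ or $a=b$ is positive. A super filling is a map $\sigma:\mathrm{dg}(\lambda)\to\mathcal A$. A cell $u=(r,i)$ with $r>1$ is a descent if $I(\sigma(u),\sigma((r-1,i)))=1$, and $\mathrm{maj}(\sigma)=\sum_{\text{descents }u}(\mathrm{leg}(u)+1)$. A triple is either three cells $(r+1,i),(r,i),(r,j)$ with $i<j$, or (degenerate) two cells $(r,i),(r,j)$ with $i<j$ and $\lambda_i=r$; with $a=\sigma((r+1,i))$ ($a=0$ if degenerate), $b=\sigma((r,i))$, $c=\sigma((r,j))$, it is a quinv triple iff exactly one of the three conditions $I(a,b)=1$, $I(c,b)=0$, $I(a,c)=0$ holds; $\mathrm{quinv}(\sigma)$ is the number of quinv triples. $|\sigma|$ is the filling $u\mapsto|\sigma(u)|$, $x^{|\sigma|}=\prod_u x_{|\sigma(u)|}$, and $p(\sigma)$, $m(\sigma)$ are the numbers of cells with positive, resp. negative, entries. Two distinct cells $(r,i)$ and $(r',j)$ with $i<j$ form an attacking pair if $r=r'$ or $r=r'+1$. *)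

(* Defs.v *)
From HB Require Import structures.
From mathcomp Require Import all_boot all_order all_algebra.
From mathcomp Require Import fraction.
From mathcomp Require Import mpoly.
Set Implicit Arguments. Unset Strict Implicit. Unset Printing Implicit Defensive.
Import GRing.Theory.
Local Open Scope ring_scope.

Definition Qqt : fieldType := {fraction {mpoly rat[2]}}.
Definition qq : Qqt := @FracField.tofrac {mpoly rat[2]} ('X_(0 : 'I_2)).
Definition tt_ : Qqt := @FracField.tofrac {mpoly rat[2]} ('X_(1 : 'I_2)).
Definition is_partition (la : seq nat) : bool :=
  sorted geq la && all (fun x => 0 < x)%N la.
Definition is_partition_of (d : nat) (mu : seq nat) : bool :=
  is_partition mu && (sumn mu == d).
Definition dominated (mu la : seq nat) : bool :=
  (sumn mu == sumn la) &&
  all (fun i => sumn (take i mu) <= sumn (take i la))%N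
      (iota 0 (size mu + size la).+1).

(* Letters of the super alphabet.  A letter is a pair (n, b) with      *)
(* |letter| = n >= 1 and b = true iff it is negative (n bar);          *)
(* the extra letter 0 is encoded as (0, false).                        *)
Definition letter := (nat * bool)%type.
Definition zero_letter : letter := (0%N, false).
Definition lt1 (a b : letter) : bool :=
  (a.1 < b.1)%N || ((a.1 == b.1) && ~~ a.2 && b.2).
Definition Ind (a b : letter) : bool := lt1 b a || ((a == b) && a.2).

(* Diagram combinatorics (1-indexed: row r from the bottom,            *)
(* column i from the left, column i has height la_i = nth 0 la i.-1).  *)
Definition colh (la : seq nat) (i : nat) : nat := nth 0%N la i.-1.
Definition in_dg (la : seq nat) (r i : nat) : bool :=
  (0 < i <= size la)%N && (0 < r <= colh la i)%N.
Definition leg (la : seq nat) (r i : nat) : nat := (colh la i - r)%N.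

(* A super filling with letters of absolute value in {1..N} is encoded *)
(* as a grid function with value Some (j, b) (the letter of absolute   *)
(* value j+1, negative iff b) on the cells of dg(la) and None outside. *)
Definition gridT (la : seq nat) (N : nat) : finType :=
  {ffun 'I_(head 0%N la) * 'I_(size la) -> option ('I_N * bool)}.

Definition is_filling (la : seq nat) N (F : gridT la N) : bool :=
  [forall c : 'I_(head 0%N la) * 'I_(size la),
     (F c != None) == in_dg la (c.1).+1 (c.2).+1].

Definition entry (la : seq nat) N (F : gridT la N) (r i : nat) : letter :=
  if in_dg la r i then
    match (insub r.-1 : option 'I_(head 0%N la)),
          (insub i.-1 : option 'I_(size la)) with
    | Some a, Some b =>
        match F (a, b) with
        | Some (j, s) => ((nat_of_ord j).+1, s)
        | None => zero_letter
        end
    | _, _ => zero_letter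
    end
  else zero_letter.

Definition maj (la : seq nat) N (F : gridT la N) : nat :=
  \sum_(1 <= i < (size la).+1) \sum_(2 <= r < (colh la i).+1)
    (if Ind (entry F r i) (entry F r.-1 i) then (leg la r i).+1 else 0%N).

(* quinv: number of quinv triples.  For i < j and r with (r,i),(r,j)  *)
(* in dg(la): if (r+1,i) is in dg(la) it is a genuine triple, with    *)
(* a = entry at (r+1,i); otherwise la_i = r and it is degenerate, a=0. *)
Definition quinv_triple (a b c : letter) : bool :=
  (Ind a b + ~~ Ind c b + ~~ Ind a c == 1)%N.

Definition quinv (la : seq nat) N (F : gridT la N) : nat :=
  \sum_(1 <= i < (size la).+1) \sum_(i.+1 <= j < (size la).+1)
  \sum_(1 <= r < (head 0%N la).+1)
    (if in_dg la r i && in_dg la r j then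
       let a := if in_dg la r.+1 i then entry F r.+1 i else zero_letter in
       quinv_triple a (entry F r i) (entry F r j)
     else false).

Definition non_attacking (la : seq nat) N (F : gridT la N) : bool :=
  [forall i : 'I_(size la).+1, forall j : 'I_(size la).+1,
   forall r : 'I_(head 0%N la).+1, forall r' : 'I_(head 0%N la).+1,
     [&& (0 < i)%N, (i < j)%N, in_dg la r i, in_dg la r' j &
         ((nat_of_ord r == r') || (nat_of_ord r == r'.+1))]
     ==> ((entry F r i).1 != (entry F r' j).1)].

Definition mneg (la : seq nat) N (F : gridT la N) : nat :=
  #|[pred c | if F c is Some (_, true) then true else false]|.
Definition ppos (la : seq nat) N (F : gridT la N) : nat :=
  #|[pred c | if F c is Some (_, false) then true else false]|.

Definition all_positive (la : seq nat) N (F : gridT la N) : bool :=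
  [forall c, if F c is Some (_, true) then false else true].

Definition xmon (la : seq nat) N (F : gridT la N) : {mpoly Qqt[N]} :=
  \prod_(c : 'I_(head 0%N la) * 'I_(size la))
     (if F c is Some (j, _) then 'X_j else 1).

Definition Cmac (la : seq nat) (N : nat) : {mpoly Qqt[N]} :=
  \sum_(F : gridT la N | is_filling F && all_positive F)
     (qq ^+ maj F * tt_ ^+ quinv F) *: xmon F.

Definition Csuper (la : seq nat) (N : nat) : {mpoly Qqt[N]} :=
  \sum_(F : gridT la N | is_filling F && non_attacking F)
     ((-1) ^+ mneg F * qq ^+ maj F * tt_ ^+ (ppos F + quinv F)) *: xmon F.

Definition psum (N m : nat) : {mpoly Qqt[N]} := \sum_(i < N) 'X_i ^+ m.
Definition psum_part (N : nat) (mu : seq nat) : {mpoly Qqt[N]} :=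
  \prod_(m <- mu) psum N m.

Definition msym_part (N : nat) (mu : seq nat) : {mpoly Qqt[N]} :=
  \sum_(m : 'X_{1..N < (sumn mu).+1} |
          sort geq [seq x <- [seq (m : 'X_{1..N}) i | i <- enum 'I_N] | (0 < x)%N]
          == mu)
     'X_[(m : 'X_{1..N})].

Definition psum_expansion (N d : nat) (s : seq (Qqt * seq nat))
    (f : {mpoly Qqt[N]}) : Prop :=
  all (fun x => is_partition_of d x.2) s /\
  f = \sum_(x <- s) x.1 *: psum_part N x.2.

(* image of such an expansion under the plethysm f |-> f[X(t-1)] *)
Definition pleth_tm1 (N : nat) (s : seq (Qqt * seq nat)) : {mpoly Qqt[N]} :=
  \sum_(x <- s) (x.1 * \prod_(m <- x.2) (tt_ ^+ m - 1)) *: psum_part N x.2.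

(* Main.v *)
Require Import Defs.
From HB Require Import structures.
From mathcomp Require Import all_boot all_order all_algebra.
From mathcomp Require Import fraction.
From mathcomp Require Import mpoly.
From mathcomp Require Import fingroup perm zify ring.
Set Implicit Arguments. Unset Strict Implicit. Unset Printing Implicit Defensive.
Import GRing.Theory.
Local Open Scope ring_scope.

(** The identity quinv(a, b, c) + I(a, b) = I(c, b) + I(a, c) turns
    q^maj t^quinv into a product over ordered pairs of cells (v, u) of
    beta(v, u)^I(sigma u, sigma v), where beta = t on attacking pairs,
    beta = q^(leg u + 1) / t^arm when v lies just below u, and beta = 1
    otherwise. In reading order, every pair of cells nested inside a pair with
    beta <> 1 is attacking. This makes the sum over the fillings with two
    prescribed adjacent letters symmetric in these letters, hence C_lambda
    symmetric.

    Superization: call a functional of weighted signed alphabets supersymmetric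
    of degree d if it ignores letters of weight 0, if its alternating sums over
    the subsets of more than d letters vanish, and if deleting a positive
    letter of weight - y together with a negative letter of weight y next above
    it changes nothing. The sum over fillings and the plethystic value of a
    power-sum expansion are both supersymmetric of degree |lambda|. A
    supersymmetric functional of degree d that vanishes on N >= d positive
    letters is zero: alternating sums reduce long positive alphabets to short
    ones, and, to eliminate a negative letter of weight y, insert d + 1
    positive letters of weight - y just below it; in the alternating sum over
    the sets of inserted letters, the negative letter cancels from every term
    except that of the empty set.

    In the full super sum, flipping the sign of the first cell attacked by a
    cell of the same absolute value cancels the attacking fillings. In a
    non-attacking filling the entries of a row are distinct in absolute value,
    which gives the dominance bound. *)

(** * Sign-reversing involutions *)

Lemma sum_sign_reversing (K : pzRingType) (J : finType) (P : pred J)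
    (F : J -> K) (phi : J -> J) :
  GRing.lreg (2%:R : K) -> involutive phi -> (forall s, P (phi s) = P s) ->
  (forall s, P s -> F (phi s) = - F s) -> \sum_(s | P s) F s = 0.
Proof.
move=> reg2 phiK Pphi Fphi; apply: reg2; rewrite mulr0 mulr_natl mulr2n.
rewrite {1}(reindex_inj (inv_inj phiK)) (eq_bigl _ _ Pphi) -big_split big1 //.
by move=> s Ps; rewrite /= Fphi // addNr.
Qed.

Section FlipFirst.
Variables (T L : finType) (key : T -> nat) (phi : L -> L).
Variable bad : {ffun T -> L} -> pred T.
Hypotheses (key_inj : injective key) (phiK : involutive phi).
Hypothesis bad_flip : forall s s' : {ffun T -> L},
  (forall u, s' u = s u \/ s' u = phi (s u)) -> bad s' =1 bad s.

Definition first_bad (s : {ffun T -> L}) (u : T) : bool :=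
  bad s u && [forall v, bad s v ==> (key u <= key v)%N].

Definition flip_at (u0 : T) (s : {ffun T -> L}) : {ffun T -> L} :=
  [ffun u => if u == u0 then phi (s u) else s u].

Definition flip_first (s : {ffun T -> L}) : {ffun T -> L} :=
  [ffun u => if first_bad s u then phi (s u) else s u].

Lemma first_bad_le s u v : first_bad s u -> bad s v -> (key u <= key v)%N.
Proof. by case/andP=> _ /forallP/(_ v)/implyP. Qed.

Lemma first_bad_exists s u : bad s u -> exists u0, first_bad s u0.
Proof.
move=> bu; case: (@arg_minnP T u (bad s) key bu) => u0 bu0 u0min.
by exists u0; rewrite /first_bad bu0; apply/forallP => v; apply/implyP/u0min.
Qed.

Lemma flip_firstE s u0 : first_bad s u0 -> flip_first s = flip_at u0 s.
Proof.
move=> fu0; apply/ffunP => u; rewrite !ffunE; case: (eqVneq u u0) => [->|ne].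
  by rewrite fu0.
rewrite ifN //; apply: contra ne => fu; apply/eqP/key_inj/eqP.
have [[bu _] [bu0 _]] := (andP fu, andP fu0).
by rewrite eqn_leq (first_bad_le fu bu0) (first_bad_le fu0 bu).
Qed.

Lemma bad_flip_first s : bad (flip_first s) =1 bad s.
Proof. by apply: bad_flip => u; rewrite ffunE; case: ifP; [right | left]. Qed.

Lemma flip_firstK : involutive flip_first.
Proof.
move=> s; apply/ffunP => u; rewrite ffunE.
have -> : first_bad (flip_first s) u = first_bad s u.
  rewrite /first_bad bad_flip_first; congr (_ && _).
  by apply: eq_forallb => v; rewrite bad_flip_first.
by rewrite ffunE; case: (first_bad s u); rewrite ?phiK.
Qed.

Lemma sum_flip_first (K : pzRingType) (F : {ffun T -> L} -> K) :
  GRing.lreg (2%:R : K) ->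
  (forall s u0, first_bad s u0 -> F (flip_at u0 s) = - F s) ->
  \sum_(s | [exists u, bad s u]) F s = 0.
Proof.
move=> reg2 Fflip; apply: (sum_sign_reversing reg2 flip_firstK) => s.
  by apply: eq_existsb; apply: bad_flip_first.
by case/existsP=> u /first_bad_exists[u0 fu0]; rewrite (flip_firstE fu0) Fflip.
Qed.

End FlipFirst.

(** * Sums over two letters *)

Section CutSum.
Variables (K : comNzRingType) (T : finType).
Implicit Types (S A : {set T}) (beta : T -> T -> K) (x y : K).

Definition cut_wt beta S A : K :=
  \prod_(v in S :\: A) \prod_(u in A) beta v u.

Definition cut_sum beta S x y : K :=
  \sum_(A : {set T} | A \subset S)
     cut_wt beta S A * (x ^+ #|S :\: A| * y ^+ #|A|).

Definition drop_pair beta (v u : T) : T -> T -> K :=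
  fun v' u' => if (v', u') == (v, u) then 1 else beta v' u'.

Lemma setDKsub S A : A \subset S -> S :\: (S :\: A) = A.
Proof. by move=> sAS; rewrite setDDr setDv set0U; apply/setIidPr. Qed.

Lemma cut_sumC_eq1 beta S x y :
  (forall v u, v \in S -> u \in S -> beta v u = 1) ->
  cut_sum beta S x y = cut_sum beta S y x.
Proof.
move=> beta1; have cut_wt1 A : A \subset S -> cut_wt beta S A = 1.
  move=> /subsetP sAS; apply: big1 => v /setDP[vS _].
  by apply: big1 => u /sAS; apply: beta1.
rewrite /cut_sum (reindex_onto (setD S) (setD S)) /=; last exact: setDKsub.
apply: eq_big => [A|A /andP[_ /eqP sAS]]; last first.
  have AS : A \subset S by rewrite -sAS subsetDl.
  by rewrite sAS !cut_wt1 ?subsetDl //; congr (_ * _); apply: mulrC.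
by rewrite subsetDl; apply/eqP/idP => [<-|/setDKsub//]; apply: subsetDl.
Qed.

Section Pair.
Variables (S : {set T}) (v u : T).
Hypotheses (vS : v \in S) (uS : u \in S) (neq_vu : v != u).
Local Notation S' := (S :\: [set v; u]).

Lemma sub_pairC A : A \subset S' -> (v \notin A) && (u \notin A).
Proof.
move=> sAS'; apply/andP; split; apply: contraL sAS' => wA; apply/subsetPn.
  by exists v; rewrite // !inE eqxx.
by exists u; rewrite // !inE eqxx orbT.
Qed.

Lemma setD_pairU1 A : A \subset S' -> S :\: (u |: A) = v |: (S' :\: A).
Proof.
move=> /sub_pairC/andP[vA _]; apply/setP => w; rewrite !inE negb_or.
case: (eqVneq w v) => [->|_] /=; first by rewrite vS neq_vu vA.
by case: (w == u); case: (w \in A).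
Qed.

Lemma cut_wtU1 beta A : A \subset S' ->
  cut_wt beta S (u |: A) =
  beta v u * (\prod_(w in A) beta v w * \prod_(w in S' :\: A) beta w u) *
  cut_wt beta S' A.
Proof.
move=> sAS'; have /andP[_ uA] := sub_pairC sAS'.
have vS'A : v \notin S' :\: A by rewrite !inE eqxx andbF.
rewrite /cut_wt setD_pairU1 // big_setU1 //= big_setU1 //= -!mulrA.
congr (_ * (_ * _)); rewrite -big_split /=.
by apply: eq_bigr => w _; rewrite big_setU1.
Qed.

Lemma sum_separating (V : nmodType) (F : {set T} -> V) :
  \sum_(A : {set T} | (A \subset S) && ((v \notin A) && (u \in A))) F A =
  \sum_(A : {set T} | A \subset S') F (u |: A).
Proof.
rewrite (reindex_onto (fun A => u |: A) (fun A => A :\ u)) /=; last first.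
  by move=> A /andP[_ /andP[_ uA]]; rewrite setD1K.
apply: eq_bigl => A; apply/idP/idP => [|sAS'].
  case/andP=> /and3P[/subsetP sAS vA _] /eqP eA; apply/subsetP => w wA.
  rewrite !inE sAS ?inE ?wA ?orbT // andbT negb_or; apply/andP; split.
    by apply: contraNneq vA => <-; rewrite !inE wA orbT.
  by move: wA; rewrite -eA !inE => /andP[].
have /andP[vA uA] := sub_pairC sAS'.
rewrite subUset sub1set uS (subset_trans sAS') ?subsetDl //= !inE eqxx.
by rewrite (negPf neq_vu) (negPf vA) setU1K ?eqxx.
Qed.

Lemma cut_wt_drop_pair beta A : ~~ ((v \notin A) && (u \in A)) ->
  cut_wt (drop_pair beta v u) S A = cut_wt beta S A.
Proof.
move=> nsep; apply: eq_bigr => v' /setDP[_ v'A]; apply: eq_bigr => u' u'A.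
rewrite /drop_pair; case: eqP => // -[ev eu]; case/negP: nsep.
by rewrite -ev -eu v'A.
Qed.

Lemma cut_wtU1_drop_pair beta A : A \subset S' ->
  cut_wt (drop_pair beta v u) S (u |: A) =
  \prod_(w in A) beta v w * \prod_(w in S' :\: A) beta w u * cut_wt beta S' A.
Proof.
move=> sAS'; have /andP[_ uA] := sub_pairC sAS'.
rewrite cut_wtU1 // {1}/drop_pair eqxx mul1r; congr (_ * _ * _).
- apply: eq_bigr => w wA; rewrite /drop_pair; case: eqP => // -[wu].
  by rewrite -wu wA in uA.
- apply: eq_bigr => w /setDP[wS' _]; rewrite /drop_pair; case: eqP => // -[wv].
  by rewrite wv !inE eqxx in wS'.
apply: eq_bigr => v' /setDP[v'S' _]; apply: eq_bigr => u' _.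
rewrite /drop_pair; case: eqP => // -[v'v _].
by rewrite v'v !inE eqxx in v'S'.
Qed.

Lemma cut_sumB_drop_pair beta x y :
  cut_sum beta S x y - cut_sum (drop_pair beta v u) S x y =
  (beta v u - 1) * (x * y) *
  \sum_(A : {set T} | A \subset S')
     (\prod_(w in A) beta v w * \prod_(w in S' :\: A) beta w u) *
     (cut_wt beta S' A * (x ^+ #|S' :\: A| * y ^+ #|A|)).
Proof.
rewrite -sumrB (bigID (fun A : {set T} => (v \notin A) && (u \in A))) /=.
rewrite [X in _ + X]big1 ?addr0; last first.
  by move=> A /andP[_ nsep]; rewrite cut_wt_drop_pair // subrr.
rewrite sum_separating mulr_sumr; apply: eq_bigr => A sAS'.
have /andP[_ uA] := sub_pairC sAS'.
rewrite cut_wtU1_drop_pair // cut_wtU1 // setD_pairU1 // !cardsU1.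
rewrite uA !inE eqxx andbF /= !exprS.
by ring.
Qed.

End Pair.

Variables (key : T -> nat) (t : K).
Hypothesis key_inj : injective key.

Definition nested S beta : Prop :=
  forall v u, v \in S -> u \in S -> beta v u != 1 ->
    (key v < key u)%N /\
    forall v' u', v' \in S -> u' \in S -> (v', u') != (v, u) ->
      (key v <= key v')%N -> (key v' < key u')%N -> (key u' <= key u)%N ->
      beta v' u' = t.

Lemma nestedS S S' beta : S' \subset S -> nested S beta -> nested S' beta.
Proof.
move=> /subsetP sS nb v u vS uS buv.
have [lt_vu beta_t] := nb v u (sS _ vS) (sS _ uS) buv.
by split=> // v' u' /sS v'S /sS u'S; apply: beta_t.
Qed.

Section Outermost.
Variables (S : {set T}) (beta : T -> T -> K) (v u : T).
Hypotheses (nb : nested S beta) (vS : v \in S) (uS : u \in S).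
Hypothesis beta_vu : beta v u != 1.
Hypothesis outermost : forall v' u', v' \in S -> u' \in S ->
  beta v' u' != 1 -> (key u' - key v' <= key u - key v)%N.
Local Notation S' := (S :\: [set v; u]).

Lemma outermost_wt w : w \in S' ->
  beta v w = (if (key v < key w < key u)%N then t else 1) /\
  beta w u = (if (key v < key w < key u)%N then t else 1).
Proof.
rewrite !inE negb_or => /andP[/andP[wv wu] wS].
have [lt_vu beta_t] := nb vS uS beta_vu.
have key_wu : key w <> key u by move/key_inj/eqP; rewrite (negPf wu).
have key_wv : key w <> key v by move/key_inj/eqP; rewrite (negPf wv).
case: ifPn => [/andP[lt_vw lt_wu]|out].
  have [le_vw le_wu] := (ltnW lt_vw, ltnW lt_wu).
  split; apply: beta_t => //; rewrite xpair_eqE.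
    by rewrite (negPf wu) andbF.
  by rewrite (negPf wv).
split; apply: contraNeq out => b1.
  have [lt_vw _] := nb vS wS b1.
  by move: key_wu lt_vw lt_vu (outermost vS wS b1); clear; lia.
have [lt_wu _] := nb wS uS b1.
by move: key_wv lt_wu lt_vu (outermost wS uS b1); clear; lia.
Qed.

Lemma cut_sum_outermost x y :
  cut_sum beta S x y =
  cut_sum (drop_pair beta v u) S x y +
  (beta v u - 1) * (x * y) *
    (\prod_(w in S') (if (key v < key w < key u)%N then t else 1) *
     cut_sum beta S' x y).
Proof.
have [lt_vu _] := nb vS uS beta_vu.
have neq_vu : v != u by apply: contraTneq lt_vu => ->; rewrite ltnn.
apply/eqP; rewrite addrC -subr_eq (cut_sumB_drop_pair vS uS neq_vu).
apply/eqP; congr (_ * _); rewrite mulr_sumr; apply: eq_bigr => A sAS'.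
congr (_ * _); rewrite [RHS](big_setID A) /= (setIidPr sAS').
congr (_ * _); apply: eq_bigr => w.
  by move=> /(subsetP sAS')/outermost_wt[].
by case/setDP=> /outermost_wt[].
Qed.

Lemma nested_drop_pair : nested S (drop_pair beta v u).
Proof.
move=> a b aS bS; rewrite {1}/drop_pair.
case: ifPn; rewrite ?eqxx // => nab bab.
have [lt_ab beta_t] := nb aS bS bab.
split=> // a' b' a'S b'S ne le_v lt_vu le_u.
rewrite /drop_pair; case: ifPn => [/eqP[ea eb]|_]; last exact: beta_t.
have long := outermost aS bS bab; subst a' b'.
have key_ne : key a <> key v \/ key b <> key u.
  case: (eqVneq a v) => [av|/eqP av]; last by left=> /key_inj.
  case: (eqVneq b u) => [bu|/eqP bu]; last by right=> /key_inj.
  by rewrite av bu eqxx in nab.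
by move: long key_ne le_v lt_vu le_u; clear; lia.
Qed.

End Outermost.

Definition nontrivial_pairs beta S : {set T * T} :=
  [set p in setX S S | beta p.1 p.2 != 1].

Lemma mem_nontrivial_pairs beta S v u :
  ((v, u) \in nontrivial_pairs beta S) = [&& v \in S, u \in S & beta v u != 1].
Proof. by rewrite !inE /= -andbA. Qed.

Lemma nontrivial_pairs_drop beta S v u :
  (v, u) \in nontrivial_pairs beta S ->
  nontrivial_pairs (drop_pair beta v u) S \proper nontrivial_pairs beta S.
Proof.
move=> vu; apply/properP; split; last first.
  by exists (v, u) => //; rewrite !inE /drop_pair eqxx eqxx andbF.
apply/subsetP => -[a b]; rewrite !inE /= /drop_pair.
by case: ifP => //; rewrite eqxx andbF.
Qed.

Lemma nontrivial_pairsD beta S v u :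
  (v, u) \in nontrivial_pairs beta S ->
  nontrivial_pairs beta (S :\: [set v; u]) \proper nontrivial_pairs beta S.
Proof.
move=> vu; apply/properP; split; last first.
  by exists (v, u) => //; rewrite !inE /= eqxx.
apply/subsetP => -[a b]; rewrite !inE /=.
by case/andP=> /andP[/andP[_ ->] /andP[_ ->]] ->.
Qed.

(* Changing the weight of an outermost pair to 1 changes the sum by a multiple
   of the sum with that pair deleted. *)
Lemma cut_sumC beta S x y : nested S beta ->
  cut_sum beta S x y = cut_sum beta S y x.
Proof.
have [n] := ubnP #|nontrivial_pairs beta S|.
elim: n S beta => // n IHn S beta; rewrite ltnS => le_n nb.
case: (set_0Vmem (nontrivial_pairs beta S)) => [no_pair|[p0 p0E]].
  apply: cut_sumC_eq1 => v u vS uS; apply/eqP; apply: contraT => bvu.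
  by rewrite -(in_set0 (v, u)) -no_pair mem_nontrivial_pairs vS uS.
case: (@arg_maxnP _ p0 (mem (nontrivial_pairs beta S))
  (fun p => key p.2 - key p.1)%N p0E) => -[v u] /= vu vu_max.
have := vu; rewrite mem_nontrivial_pairs => /and3P[vS uS bvu].
have outermost v' u' : v' \in S -> u' \in S -> beta v' u' != 1 ->
    (key u' - key v' <= key u - key v)%N.
  move=> v'S u'S bv'u'; apply: (vu_max (v', u')).
  by rewrite /= mem_nontrivial_pairs v'S u'S.
rewrite !(cut_sum_outermost nb vS uS bvu outermost); congr (_ + _).
  apply: IHn; last exact: nested_drop_pair.
  by apply: leq_trans le_n; apply/proper_card/nontrivial_pairs_drop.
rewrite (mulrC x); congr (_ * (_ * _)).
apply: IHn; last by apply: nestedS nb; apply: subsetDl.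
by apply: leq_trans le_n; apply/proper_card/nontrivial_pairsD.
Qed.

End CutSum.

(** * Signed alphabets and filling sums *)

Structure alphabet := Alphabet {
  letters :> finType;
  lrank : letters -> nat;
  negative : pred letters;
  lrank_inj : injective lrank
}.
Arguments negative {a} x.
Arguments lrank_inj : clear implicits.

(* I(x, y) = 1 in the notation of the paper. *)
Definition super_gt (A : alphabet) : rel A :=
  fun x y => (lrank y < lrank x)%N || ((x == y) && negative x).
Arguments super_gt {A} x y.

Lemma super_gt_adjacent (A : alphabet) (a b z : A) :
  (lrank a < lrank b)%N -> ~~ (lrank a < lrank z < lrank b)%N ->
  z != a -> z != b ->
  super_gt z a = super_gt z b /\ super_gt a z = super_gt b z.
Proof.
move=> lt_ab not_between za zb.
rewrite /super_gt ![_ == z]eq_sym (negPf za) (negPf zb) !orbF.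
have rank_a : lrank z <> lrank a by move/lrank_inj/eqP; apply/negP.
have rank_b : lrank z <> lrank b by move/lrank_inj/eqP; apply/negP.
by move: not_between lt_ab rank_a rank_b; clear; lia.
Qed.

Definition ord_alphabet (N : nat) : alphabet :=
  @Alphabet 'I_N val xpred0 val_inj.

Section FillingSum.
Variables (K : comNzRingType) (T : finType) (beta : T -> T -> K).
Implicit Type A : alphabet.

Definition fill_wt A (s : {ffun T -> A}) : K :=
  \prod_u \prod_v (if super_gt (s u) (s v) then beta v u else 1).

Definition fill_sum A (w : A -> K) : K :=
  \sum_(s : {ffun T -> A}) fill_wt s * \prod_u w (s u).

Section AdjacentSwap.
Variables (A : alphabet) (i j : A).
Hypotheses (pos_i : ~~ negative i) (pos_j : ~~ negative j).
Hypothesis lt_ij : (lrank i < lrank j)%N.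
Hypothesis adj_ij : forall z : A, ~~ (lrank i < lrank z < lrank j)%N.

Let neq_ij : i != j.
Proof. by apply: contraTneq lt_ij => ->; rewrite ltnn. Qed.

Definition collapse (s : {ffun T -> A}) : {ffun T -> A} :=
  [ffun u => if s u == j then i else s u].

Definition recolor (r : {ffun T -> A}) (B : {set T}) : {ffun T -> A} :=
  [ffun u => if u \in B then j else r u].

Lemma collapse_neq s u : collapse s u != j.
Proof. by rewrite ffunE; case: ifPn. Qed.

Section Fiber.
Variable r : {ffun T -> A}.
Hypothesis rj : forall u, r u != j.
Local Notation S := [set u | r u == i].

Lemma sum_collapse_fiber (F : {ffun T -> A} -> K) :
  \sum_(s | collapse s == r) F s =
  \sum_(B : {set T} | B \subset S) F (recolor r B).
Proof.
rewrite (reindex_onto (recolor r) (fun s => [set u | s u == j])) /=; last first.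
  move=> s /eqP rE; apply/ffunP => u; rewrite ffunE inE -rE ffunE.
  by case: eqP => // ->.
apply: eq_bigl => B; apply/andP/subsetP => [[/eqP rE _] u uB|sBS].
  by rewrite inE -rE !ffunE uB eqxx.
split; apply/eqP.
  apply/ffunP => u; rewrite !ffunE; case: (boolP (u \in B)) => uB; last first.
    by rewrite (negPf (rj u)).
  by rewrite eqxx; apply/esym/eqP; have := sBS u uB; rewrite inE.
apply/setP => u; rewrite !inE ffunE.
by case: (u \in B); rewrite ?eqxx // (negPf (rj u)).
Qed.

Lemma fill_wt_recolor (B : {set T}) : B \subset S ->
  fill_wt (recolor r B) = fill_wt r * cut_wt beta S B.
Proof.
move=> /subsetP sBS; have rB u : u \in B -> r u = i.
  by move/sBS; rewrite inE => /eqP.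
have Iii : super_gt i i = false by rewrite /super_gt ltnn (negPf pos_i) andbF.
have Ijj : super_gt j j = false by rewrite /super_gt ltnn (negPf pos_j) andbF.
have Iij : super_gt i j = false.
  by rewrite /super_gt (negPf neq_ij) ltnNge ltnW.
have Iji : super_gt j i by rewrite /super_gt lt_ij.
have -> : cut_wt beta S B =
    \prod_u \prod_v (if (v \in S :\: B) && (u \in B) then beta v u else 1).
  rewrite /cut_wt exchange_big big_mkcond; apply: eq_bigr => u _ /=.
  case: ifP => _; last by rewrite big1 // => v _; rewrite andbF.
  by rewrite big_mkcond; apply: eq_bigr => v _; rewrite andbT.
rewrite -big_split; apply: eq_bigr => u _; rewrite -big_split.
apply: eq_bigr => v _ /=; rewrite !inE !ffunE.
have [uB|uB] := boolP (u \in B); have [vB|vB] := boolP (v \in B) => /=.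
- by rewrite (rB u uB) (rB v vB) Iii Ijj mulr1.
- rewrite (rB u uB) andbT; case: (eqVneq (r v) i) => [->|rv].
    by rewrite Iji Iii mul1r.
  by have [_ ->] := super_gt_adjacent lt_ij (adj_ij _) rv (rj v); rewrite mulr1.
- rewrite (rB v vB) mulr1; case: (eqVneq (r u) i) => [->|ru].
    by rewrite Iij Iii.
  by have [<- _] := super_gt_adjacent lt_ij (adj_ij _) ru (rj u).
by rewrite andbF mulr1.
Qed.

Lemma prod_recolor (w : A -> K) (B : {set T}) : B \subset S ->
  \prod_u w (recolor r B u) =
  \prod_(u | r u != i) w (r u) * (w i ^+ #|S :\: B| * w j ^+ #|B|).
Proof.
move=> /subsetP sBS; have rB u : u \in B -> r u = i.
  by move/sBS; rewrite inE => /eqP.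
rewrite (bigID (fun u => r u == i)) /= mulrC; congr (_ * _).
  apply: eq_bigr => u ru; rewrite ffunE ifN //.
  by apply: contra ru => /rB ->.
rewrite (bigID (mem B)) /= mulrC -!prodr_const; congr (_ * _).
  apply: eq_big => [u|u /andP[/eqP <- uB]]; first by rewrite !inE andbC.
  by rewrite ffunE (negPf uB).
apply: eq_big => [u|u /andP[_ uB]]; last by rewrite ffunE uB.
by apply: andb_idl => /rB ->.
Qed.

Lemma fill_sum_fiber (w : A -> K) :
  \sum_(s | collapse s == r) fill_wt s * \prod_u w (s u) =
  fill_wt r * \prod_(u | r u != i) w (r u) * cut_sum beta S (w i) (w j).
Proof.
rewrite sum_collapse_fiber /cut_sum mulr_sumr; apply: eq_bigr => B sBS.
rewrite fill_wt_recolor // prod_recolor // -!mulrA; congr (_ * _).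
exact: mulrCA.
Qed.

End Fiber.

Lemma fill_sum_swap (w : A -> K) (key : T -> nat) (t : K) :
  injective key -> nested key t [set: T] beta ->
  fill_sum (fun x => w (tperm i j x)) = fill_sum w.
Proof.
move=> key_inj nb; rewrite /fill_sum.
rewrite [LHS](partition_big collapse predT) //.
rewrite [RHS](partition_big collapse predT) //.
apply: eq_bigr => r _ /=; have [/existsP[u ru]|] := boolP [exists u, r u == j].
  have no_fiber s : (collapse s == r) = false.
    by apply: contraTF ru => /eqP <-; apply: collapse_neq.
  by rewrite !(big_pred0 _ _ _ _ no_fiber).
rewrite negb_exists => /forallP rj.
rewrite (fill_sum_fiber rj (fun x => w (tperm i j x))) (fill_sum_fiber rj w).
rewrite tpermL tpermR; congr (_ * _ * _).
  by apply: eq_bigr => u ru; rewrite tpermD // eq_sym.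
by apply: (@cut_sumC _ _ key t key_inj); apply: nestedS nb; apply: subsetT.
Qed.

End AdjacentSwap.
End FillingSum.

Lemma eq_fill_sum (K : comNzRingType) (T : finType) (beta beta' : T -> T -> K)
    (A : alphabet) (w w' : A -> K) :
  beta =2 beta' -> w =1 w' -> fill_sum beta w = fill_sum beta' w'.
Proof.
move=> eq_beta eq_w; apply: eq_bigr => s _; congr (_ * _); last exact: eq_bigr.
by apply: eq_bigr => u _; apply: eq_bigr => v _; rewrite eq_beta.
Qed.

Section FillingSumMorphism.
Variables (K K' : comNzRingType) (phi : {rmorphism K -> K'}).
Variables (T : finType) (beta : T -> T -> K) (A : alphabet).

Lemma fill_wt_rmorph (s : {ffun T -> A}) :
  phi (fill_wt beta s) = fill_wt (fun v u => phi (beta v u)) s.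
Proof.
rewrite rmorph_prod; apply: eq_bigr => u _; rewrite rmorph_prod.
by apply: eq_bigr => v _; case: ifP => _ //; rewrite rmorph1.
Qed.

Lemma fill_sum_rmorph (w : A -> K) :
  phi (fill_sum beta w) =
  fill_sum (fun v u => phi (beta v u)) (fun x => phi (w x)).
Proof.
rewrite rmorph_sum; apply: eq_bigr => s _.
by rewrite rmorphM rmorph_prod fill_wt_rmorph.
Qed.

End FillingSumMorphism.

Lemma perm_adjacent_ind N (P : 'S_N -> Prop) :
  P 1%g -> (forall p p', P p -> P p' -> P (p * p')%g) ->
  (forall a b : 'I_N, b = a.+1 :> nat -> P (tperm a b)) -> forall s, P s.
Proof.
move=> P1 Pmul Padj s.
have Plt m (a b : 'I_N) : b = (a + m.+1)%N :> nat -> P (tperm a b).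
  elim: m b => [|m IHm] b ab; first by apply: Padj; rewrite ab addn1.
  have ltcN : (a + m.+1 < N)%N by have := ltn_ord b; lia.
  pose c := Ordinal ltcN.
  have Pcb : P (tperm c b) by apply: Padj; rewrite /= ab; lia.
  have neq_ac : c != a by apply/eqP => /(congr1 val) /=; lia.
  have neq_ab : b != a by apply/eqP => /(congr1 val) /=; lia.
  have -> : tperm a b = (tperm c b * tperm a c * tperm c b)%g.
    rewrite (tpermC a c) (tpermC a b) -(tpermJ_tperm neq_ac neq_ab).
    by rewrite conjgE tpermV mulgA.
  by apply: (Pmul _ _ (Pmul _ _ Pcb _) Pcb); apply: IHm.
case: (prod_tpermP s) => ts -> _.
elim: ts => [|[a b] ts IH]; first by rewrite big_nil.
rewrite big_cons; apply: Pmul => //=; case: (ltngtP a b) => [ab|ba|/val_inj ->].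
- by apply: (Plt (b - a).-1); lia.
- by rewrite tpermC; apply: (Plt (a - b).-1); lia.
by rewrite tperm1.
Qed.

Lemma fill_sum_perm (K : comNzRingType) (T : finType) (beta : T -> T -> K)
    (key : T -> nat) (t : K) N (w : ord_alphabet N -> K) (s : 'S_N) :
  injective key -> nested key t [set: T] beta ->
  @fill_sum K T beta (ord_alphabet N) (fun x => w (s x)) = fill_sum beta w.
Proof.
move=> key_inj nb; elim/perm_adjacent_ind: s w => [w|p p' IHp IHp' w|a b ab w].
- by apply: eq_fill_sum => // x; rewrite perm1.
- rewrite -[RHS]IHp' -[RHS]IHp; apply: eq_fill_sum => // x.
  by rewrite permM.
apply: (@fill_sum_swap _ _ _ (ord_alphabet N)) key_inj nb => //=.
  by rewrite ab.
by move=> z; rewrite ab ltnS ltnNge andNb.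
Qed.

(** * Supersymmetric functionals *)

Definition zero_on (K : nmodType) (L : finType) (w : L -> K) (X : {set L})
    (x : L) : K :=
  if x \in X then 0 else w x.

Lemma rank_mono_inj (A B : alphabet) (e : A -> B) :
  {mono e : x y / (lrank x < lrank y)%N} -> injective e.
Proof.
move=> e_mono x y exy; apply: lrank_inj; apply/eqP.
have := e_mono x y; have := e_mono y x; rewrite exy ltnn.
by case: ltngtP.
Qed.

Definition sub_alphabet (A : alphabet) (P : pred A) : alphabet :=
  @Alphabet {x : A | P x} (fun x => lrank (val x)) (fun x => negative (val x))
    (inj_comp (lrank_inj A) val_inj).

Section Spares.
Variables (A : alphabet) (b : A) (n : nat).

Definition spare_rank (x : (A + 'I_n)%type) : nat :=
  match x with
  | inl x => if (lrank x < lrank b)%N then lrank x else (lrank x + n)%N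
  | inr i => (lrank b + i)%N
  end.

Lemma spare_rank_inj : injective spare_rank.
Proof.
case=> [x|i] [y|j] /= E.
- congr inl; apply: lrank_inj; move: E.
  by case: (ltnP (lrank x)); case: (ltnP (lrank y)); clear; lia.
- by have := ltn_ord j; move: E; case: ltnP; clear; lia.
- by have := ltn_ord i; move: E; case: ltnP; clear; lia.
by congr inr; apply: val_inj; apply: addnI E.
Qed.

(* The letters of [A] together with [n] positive letters just below [b]. *)
Definition spare_alphabet : alphabet :=
  @Alphabet (A + 'I_n)%type spare_rank
    (fun x => if x is inl x then negative x else false) spare_rank_inj.

Definition spare_letters : {set spare_alphabet} :=
  [set x : spare_alphabet | if x is inr _ then true else false].

Lemma card_spare_letters : #|spare_letters| = n.
Proof.
have -> : spare_letters = [set inr i | i : 'I_n].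
  apply/setP => -[x|i]; rewrite inE; apply/esym; last by apply/imsetP; exists i.
  by apply/negP => /imsetP[].
by rewrite card_imset ?card_ord // => i j [].
Qed.

Lemma spare_rank_inl (x y : A) :
  (spare_rank (inl x) < spare_rank (inl y))%N = (lrank x < lrank y)%N.
Proof. rewrite /=; case: (ltnP (lrank x) (lrank b)).
all: by case: (ltnP (lrank y) (lrank b)); lia. Qed.

End Spares.

Section SupersymmetricFunctionals.
Variables (K : comNzRingType) (d : nat).

Definition alphabet_functional := forall A : alphabet, (A -> K) -> K.
Implicit Types (Phi Psi : alphabet_functional) (A B : alphabet).

Definition embedding_invariant Phi : Prop :=
  forall A B (e : A -> B) (wA : A -> K) (wB : B -> K),
    {mono e : x y / (lrank x < lrank y)%N} -> {mono e : x / negative x} ->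
    (forall x, wB (e x) = wA x) -> (forall z, z \notin codom e -> wB z = 0) ->
    Phi B wB = Phi A wA.

Definition degree_le Phi : Prop :=
  forall A (w : A -> K) (X : {set A}), (d < #|X|)%N ->
    \sum_(S : {set A} | S \subset X)
       (-1) ^+ #|S| * Phi A (zero_on w (X :\: S)) = 0.

Definition cancels_opposite Phi : Prop :=
  forall A (w : A -> K) (a b : A),
    ~~ negative a -> negative b -> (lrank a < lrank b)%N -> w a = - w b ->
    (forall z, w z != 0 -> ~~ (lrank a < lrank z < lrank b)%N) ->
    Phi A w = Phi A (zero_on w [set a; b]).

Record supersymmetric Phi : Prop := Supersymmetric {
  supersym_embed : embedding_invariant Phi;
  supersym_degree : degree_le Phi;
  supersym_cancel : cancels_opposite Phi
}.

Lemma supersymmetricB Phi Psi : supersymmetric Phi -> supersymmetric Psi ->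
  supersymmetric (fun A w => Phi A w - Psi A w).
Proof.
move=> [embP degP canP] [embQ degQ canQ]; split.
- move=> A B e wA wB e_mono e_neg wE w_out.
  by rewrite (embP A B e wA) // (embQ A B e wA).
- move=> A w X ltX; under eq_bigr do rewrite mulrBr.
  by rewrite sumrB degP // degQ // subrr.
move=> A w a b pos_a neg_b lt_ab wab adj.
by rewrite (canP A w a b) // (canQ A w a b).
Qed.

Section Vanishing.
Variables (Phi : alphabet_functional) (N : nat).
Arguments Phi : clear implicits.
Hypotheses (susy : supersymmetric Phi) (le_dN : (d <= N)%N).
Hypothesis Phi_ord : forall w, Phi (ord_alphabet N) w = 0.

Lemma eq_functional A (w w' : A -> K) : w =1 w' -> Phi A w = Phi A w'.
Proof.
by move=> ww'; apply: (supersym_embed susy (e := id)) => // z; rewrite codom_f.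
Qed.

Lemma functional_sub A (P : pred A) (w : A -> K) :
  (forall x, w x != 0 -> P x) ->
  Phi A w = Phi (sub_alphabet P) (fun x => w (val x)).
Proof.
move=> supp; pose e (x : sub_alphabet P) : A := val x.
apply: (supersym_embed susy (e := e)) => // z.
by apply: contraNeq => wz; apply/codomP; exists (exist _ z (supp z wz)).
Qed.

Lemma degree_le_isolate A (w : A -> K) (X S0 : {set A}) :
  (d < #|X|)%N -> S0 \subset X ->
  (forall S : {set A}, S \subset X -> S != S0 ->
     Phi A (zero_on w (X :\: S)) = 0) ->
  Phi A (zero_on w (X :\: S0)) = 0.
Proof.
move=> ltX sS0 others; have := supersym_degree susy w ltX.
rewrite (bigD1 S0) //= big1 ?addr0; last first.
  by move=> S /andP[sS neS]; rewrite others ?mulr0.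
by move/eqP; rewrite -signr_odd mulr_sign; case: odd; rewrite ?oppr_eq0 => /eqP.
Qed.

Section SmallSupport.
Variables (A : alphabet) (w : A -> K).

Definition supp_below (x : A) : {set A} :=
  [set y | (w y != 0) && (lrank y < lrank x)%N].

Lemma card_supp_below_mono (x y : A) : w x != 0 -> w y != 0 ->
  (#|supp_below x| < #|supp_below y|)%N = (lrank x < lrank y)%N.
Proof.
have sub x' y' :
    (lrank x' <= lrank y')%N -> supp_below x' \subset supp_below y'.
  move=> le; apply/subsetP => z; rewrite !inE => /andP[-> lt].
  exact: leq_trans lt le.
move=> wx wy; case: (leqP (lrank y) (lrank x)) => [le|lt].
  by apply/negbTE; rewrite -leqNgt; apply/subset_leq_card/sub.
apply/proper_card/properP; split; first exact/sub/ltnW.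
by exists x; rewrite inE wx ?lt ?ltnn.
Qed.

Lemma card_supp_below_lt x : w x != 0 ->
  (#|supp_below x| < #|[set y | w y != 0%R]|)%N.
Proof.
move=> wx; apply/proper_card/properP; split.
  by apply/subsetP => y; rewrite !inE => /andP[].
by exists x; rewrite inE ?ltnn ?andbF.
Qed.

Lemma functional_eq0_small :
  (forall x, negative x -> w x = 0) -> (#|[set x | w x != 0%R]| <= N)%N ->
  Phi A w = 0.
Proof.
move=> w_neg leN; pose supp : pred A := fun x => w x != 0.
pose e (x : sub_alphabet supp) : ord_alphabet N :=
  Ordinal (leq_trans (card_supp_below_lt (valP x)) leN).
have e_mono x y : (lrank (e x) < lrank (e y))%N = (lrank x < lrank y)%N.
  exact: card_supp_below_mono (valP x) (valP y).
pose w' z := if [pick x | e x == z] is Some x then w (val x) else 0.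
rewrite (@functional_sub _ supp) // -(Phi_ord w'); apply/esym.
apply: (supersym_embed susy e_mono) => [x|x|z].
- by apply/esym/negP => /w_neg/eqP; apply/negP; apply: (valP x).
- rewrite /w'; case: pickP => [y /eqP/(rank_mono_inj e_mono) -> //|/(_ x)].
  by rewrite eqxx.
move=> ze; rewrite /w'; case: pickP => // x /eqP xz.
by rewrite -xz codom_f in ze.
Qed.

End SmallSupport.

Lemma functional_eq0_positive A (w : A -> K) :
  (forall x, negative x -> w x = 0) -> Phi A w = 0.
Proof.
have [n] := ubnP (#|[set x | w x != 0%R]|).
elim: n w => // n IHn w; rewrite ltnS; set X := [set x | _] => leX w_neg.
have [leN|ltN] := leqP #|X| N; first exact: functional_eq0_small.
rewrite (@eq_functional _ w (zero_on w (X :\: X))); last first.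
  by move=> x; rewrite /zero_on setDv inE.
apply: degree_le_isolate => // [|S sSX neS]; first exact: leq_ltn_trans ltN.
apply: IHn => [|x /w_neg wx]; last by rewrite /zero_on wx if_same.
apply: leq_trans leX; apply: leq_ltn_trans (_ : #|S| < _)%N; last first.
  by apply: proper_card; rewrite properEneq neS.
apply/subset_leq_card/subsetP => x; rewrite inE /zero_on !inE.
by case: (x \in S) => //=; case: (w x =P 0) => [->|]; rewrite ?eqxx.
Qed.

Definition neg_supp A (w : A -> K) : {set A} :=
  [set x | negative x && (w x != 0)].

Section SpareCancellation.
Variables (A : alphabet) (w : A -> K) (b : A).
Hypotheses (neg_b : negative b) (wb : w b != 0).
Local Notation A' := (spare_alphabet b d.+1).
Local Notation X := (spare_letters b d.+1).

Definition spare_wt (x : A') : K := if x is inl y then w y else - w b.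

Lemma functional_spare : Phi A w = Phi A' (zero_on spare_wt (X :\: set0)).
Proof.
pose e (x : A) : A' := inl x; apply/esym.
apply: (supersym_embed susy (e := e)) => //.
- exact: spare_rank_inl.
- by move=> x; rewrite /zero_on !inE.
case=> [x|i] ze; last by rewrite /zero_on !inE.
by rewrite (codom_f e x) in ze.
Qed.

(* The highest remaining spare letter cancels with [b]. *)
Lemma functional_spare_cancel (S : {set A'}) : S \subset X -> S != set0 ->
  exists2 w' : A' -> K, Phi A' (zero_on spare_wt (X :\: S)) = Phi A' w' &
    (#|neg_supp w'| < #|neg_supp w|)%N.
Proof.
move=> /subsetP sSX /set0Pn[y0 y0S].
case: (@arg_maxnP _ y0 (mem S) (@lrank A') y0S) => -[y|i] yS ymax.
  by have := sSX _ yS; rewrite inE.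
have {}ymax z : z \in S -> (lrank z <= lrank (inr i : A'))%N by apply: ymax.
set w2 := zero_on _ _; exists (zero_on w2 [set (inr i : A'); inl b]).
  apply: (supersym_cancel susy) => //.
  - by rewrite /= ltnn ltn_add2l ltn_ord.
  - by rewrite /w2 /zero_on !inE (yS : inr i \in S) andbF.
  case=> [x|j] wz; first by rewrite /= ltnn; case: (ltnP (lrank x)); lia.
  rewrite negb_and -leqNgt; apply/orP; left; apply: ymax.
  by apply: contraNT wz => jS; rewrite /w2 /zero_on !inE jS.
apply: leq_ltn_trans (_ : #|[set (inl x : A') | x in neg_supp w :\ b]| < _)%N.
  apply/subset_leq_card/subsetP => -[x|j]; rewrite !inE //= => /andP[neg_x].
  rewrite {1}/zero_on !inE /=; case: ifPn; rewrite ?eqxx // => xb.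
  rewrite /w2 /zero_on !inE andbF /= => wx; apply/imsetP; exists x => //.
  by rewrite !inE xb neg_x.
rewrite card_imset; last by move=> x x' [].
by rewrite [X in (_ < X)%N](cardsD1 b) !inE neg_b wb.
Qed.

End SpareCancellation.

Theorem functional_eq0 A (w : A -> K) : Phi A w = 0.
Proof.
have [n] := ubnP #|neg_supp w|.
elim: n A w => // n IHn A w; rewrite ltnS => le_n.
case: (set_0Vmem (neg_supp w)) => [no_neg|[b]].
  apply: functional_eq0_positive => x neg_x; apply/eqP; apply: contraT => wx.
  by rewrite -(in_set0 x) -no_neg inE neg_x.
rewrite inE => /andP[neg_b wb]; rewrite (functional_spare w b).
apply: degree_le_isolate => [||S sSX S0]; first by rewrite card_spare_letters.
  exact: sub0set.
have [w' -> lt_w'] := functional_spare_cancel neg_b wb sSX S0.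
by apply: IHn; apply: leq_trans lt_w' le_n.
Qed.

End Vanishing.

Corollary supersymmetric_eq Phi Psi N :
  supersymmetric Phi -> supersymmetric Psi -> (d <= N)%N ->
  (forall w, Phi (ord_alphabet N) w = Psi (ord_alphabet N) w) ->
  forall A w, Phi A w = Psi A w.
Proof.
move=> susyP susyQ le_dN PQ A w; apply/eqP; rewrite -subr_eq0; apply/eqP.
apply: (functional_eq0 (supersymmetricB susyP susyQ) le_dN) => w'.
by rewrite PQ subrr.
Qed.

End SupersymmetricFunctionals.

Definition toggle (T : finType) (b : T) (S : {set T}) : {set T} :=
  if b \in S then S :\ b else b |: S.

Lemma toggleK (T : finType) (b : T) : involutive (toggle b).
Proof.
move=> S; rewrite /toggle; case: (boolP (b \in S)) => bS.
  by rewrite !inE eqxx /= setD1K.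
by rewrite !inE eqxx setU1K.
Qed.

Lemma toggle_subset (T : finType) (b : T) (S X : {set T}) : b \in X ->
  (toggle b S \subset X) = (S \subset X).
Proof.
move=> bX; rewrite /toggle; case: ifP => bS; last by rewrite subUset sub1set bX.
by rewrite -{2}(setD1K bS) subUset sub1set bX.
Qed.

Lemma in_toggle (T : finType) (b x : T) (S : {set T}) : x != b ->
  (x \in toggle b S) = (x \in S).
Proof. by rewrite /toggle => /negPf xb; case: ifP; rewrite !inE xb. Qed.

Lemma sign_card_toggle (K : pzRingType) (T : finType) (b : T) (S : {set T}) :
  (-1) ^+ #|toggle b S| = - (-1) ^+ #|S| :> K.
Proof.
rewrite /toggle; case: ifP => bS; last by rewrite cardsU1 bS exprS mulN1r.
by rewrite [in RHS](cardsD1 b) bS exprS mulN1r opprK.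
Qed.

Lemma sum_zero_on_eq0 (K : comNzRingType) (L J : finType)
    (c : {ffun J -> L} -> K) (g : J -> L -> K -> K) (w : L -> K) (X : {set L}) :
  GRing.lreg (2%:R : K) -> (#|J| < #|X|)%N ->
  \sum_(S : {set L} | S \subset X) (-1) ^+ #|S| *
     \sum_(f : {ffun J -> L})
        c f * \prod_i g i (f i) (zero_on w (X :\: S) (f i)) = 0.
Proof.
move=> reg2 ltJX; under eq_bigr do rewrite mulr_sumr.
rewrite exchange_big /=; apply: big1 => f _.
have [b bX bf] : exists2 b, b \in X & b \notin codom f.
  apply/exists_inP; apply: contraTT ltJX; rewrite negb_exists_in -leqNgt.
  move=> /forall_inP Xf; rewrite -(size_codom f) (leq_trans _ (card_size _)) //.
  by apply/subset_leq_card/subsetP => b /Xf; rewrite negbK.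
apply: (sum_sign_reversing reg2 (toggleK b)) => S; first exact: toggle_subset.
rewrite sign_card_toggle mulNr => _; congr (- (_ * (_ * _))).
apply: eq_bigr => i _; rewrite /zero_on !inE in_toggle //.
by apply: contraNneq bf => <-; apply: codom_f.
Qed.

Section FillingSumSupersymmetric.
Variables (K : comNzRingType) (T : finType).
Variables (beta : T -> T -> K) (key : T -> nat).
Hypothesis reg2 : GRing.lreg (2%:R : K).
Hypothesis key_inj : injective key.
Hypothesis beta_key : forall v u, beta v u != 1 -> (key v < key u)%N.

Lemma fill_sum_embed : embedding_invariant (@fill_sum K T beta).
Proof.
move=> A B e wA wB e_mono e_neg wE w_out; have e_inj := rank_mono_inj e_mono.
pose h (s : {ffun T -> A}) : {ffun T -> B} := [ffun u => e (s u)].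
have h_inj : injective h.
  move=> s s' /ffunP hss'; apply/ffunP => u.
  by have := hss' u; rewrite !ffunE => /e_inj.
rewrite /fill_sum (bigID (mem (h @: [set: {ffun T -> A}]))) /=.
rewrite [X in _ + X]big1 ?addr0 => [|s s_out]; last first.
  have [/existsP[u su]|] := boolP [exists u, s u \notin codom e].
    by rewrite (bigD1 u) //= w_out // mul0r mulr0.
  rewrite negb_exists => /forallP s_in; case/negP: s_out.
  have {}s_in u : s u \in codom e by have := s_in u; rewrite negbK.
  apply/imsetP; exists [ffun u => iinv (s_in u)]; first by rewrite inE.
  by apply/ffunP => u; rewrite !ffunE f_iinv.
rewrite big_imset /=; last by move=> s s' _ _; apply: h_inj.
apply: eq_big => [s|s _]; first by rewrite inE.
congr (_ * _); last by apply: eq_bigr => u _; rewrite ffunE.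
apply: eq_bigr => u _; apply: eq_bigr => v _.
by rewrite !ffunE /super_gt e_mono e_neg (inj_eq e_inj).
Qed.

Section Cancellation.
Variables (A : alphabet) (w : A -> K) (a b : A).
Hypotheses (pos_a : ~~ negative a) (neg_b : negative b).
Hypotheses (lt_ab : (lrank a < lrank b)%N) (wab : w a = - w b).
Hypothesis adj : forall z, w z != 0 -> ~~ (lrank a < lrank z < lrank b)%N.
Local Notation ab := [set a; b].
Local Notation bad := (fun (s : {ffun T -> A}) (u : T) => s u \in ab).

Lemma super_gt_tpermr (x y : A) : w x != 0 ->
  super_gt x (tperm a b y) = super_gt x y.
Proof.
move=> wx; suff E : super_gt x a = super_gt x b by case: tpermP => [->|->|].
case: (eqVneq x a) => [->|xa].
  by rewrite /super_gt ltnn (negPf pos_a) !andbF orbF ltnNge ltnW.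
case: (eqVneq x b) => [->|xb]; first by rewrite /super_gt lt_ab neg_b eqxx orbT.
by have [] := super_gt_adjacent lt_ab (adj wx) xa xb.
Qed.

Lemma super_gt_tperml (x y : A) : w y != 0 -> y \notin ab ->
  super_gt (tperm a b x) y = super_gt x y.
Proof.
move=> wy; rewrite !inE negb_or => /andP[ya yb].
have [_ E] := super_gt_adjacent lt_ab (adj wy) ya yb.
by case: tpermP => [->|->|].
Qed.

Lemma tperm_weight_eq0 (x : A) : (w (tperm a b x) == 0) = (w x == 0).
Proof. by case: tpermP => [->|->|] //; rewrite wab oppr_eq0. Qed.

Lemma fill_wt_flip (s : {ffun T -> A}) (u0 : T) :
  (forall u, w (s u) != 0) -> first_bad key bad s u0 ->
  fill_wt beta (flip_at (tperm a b) u0 s) = fill_wt beta s.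
Proof.
move=> wne0 first_u0; apply: eq_bigr => u _; apply: eq_bigr => v _.
have [->|/beta_key lt_vu] := eqVneq (beta v u) 1; first by rewrite !if_same.
rewrite !ffunE; case: (eqVneq u u0) => [uu0|_]; last first.
  by case: (v == u0); rewrite ?super_gt_tpermr.
have v_good : s v \notin ab.
  by apply: contraTN lt_vu => /(first_bad_le first_u0); rewrite -leqNgt uu0.
have /negPf -> : v != u0.
  by apply: contraNneq v_good => ->; case/andP: first_u0.
by rewrite super_gt_tperml.
Qed.

Lemma sum_opposite_eq0 :
  \sum_(s : {ffun T -> A} | [exists u, s u \in ab])
     fill_wt beta s * \prod_u w (s u) = 0.
Proof.
have abE x : (tperm a b x \in ab) = (x \in ab).
  by rewrite !inE; case: tpermP => [->|->|]; rewrite ?eqxx ?orbT.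
apply: (sum_flip_first (bad := bad) key_inj (@tpermK _ a b)) => //.
  move=> s s' ss' u.
  by case: (ss' u) => ->; rewrite ?abE.
move=> s u0 first_u0; have [/existsP[z wz]|] := boolP [exists z, w (s z) == 0].
  have prod0 (s' : {ffun T -> A}) : w (s' z) == 0 -> \prod_u w (s' u) = 0.
    by move=> /eqP w0; rewrite (bigD1 z) //= w0 mul0r.
  rewrite !prod0 ?mulr0 ?oppr0 // ffunE; case: ifP => // _.
  by rewrite tperm_weight_eq0.
rewrite negb_exists => /forallP wne0.
rewrite fill_wt_flip // -mulrN; congr (_ * _).
rewrite (bigD1 u0) //= [in RHS](bigD1 u0) //= -mulNr; congr (_ * _).
  have /andP[u0ab _] := first_u0; move: u0ab; rewrite ffunE eqxx !inE.
  by case/orP=> /eqP->; rewrite ?tpermL ?tpermR wab ?opprK.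
by apply: eq_bigr => u /negPf uu0; rewrite ffunE uu0.
Qed.

Lemma fill_sum_cancel : fill_sum beta w = fill_sum beta (zero_on w ab).
Proof.
rewrite /fill_sum (bigID (fun s : {ffun T -> A} => [exists u, s u \in ab])) /=.
rewrite sum_opposite_eq0 add0r.
rewrite [RHS](bigID (fun s : {ffun T -> A} => [exists u, s u \in ab])) /=.
rewrite [X in _ = X + _]big1 ?add0r => [|s /existsP[u sab]]; last first.
  by rewrite (bigD1 u) //= {1}/zero_on sab mul0r mulr0.
apply: eq_bigr => s; rewrite negb_exists => /forallP good; congr (_ * _).
by apply: eq_bigr => u _; rewrite /zero_on (negPf (good u)).
Qed.

End Cancellation.

Lemma fill_sum_degree_le : degree_le #|T| (@fill_sum K T beta).
Proof.
move=> A w X ltX.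
exact: (sum_zero_on_eq0 (@fill_wt _ _ beta A) (fun _ _ z => z)).
Qed.

Lemma fill_sum_supersymmetric : supersymmetric #|T| (@fill_sum K T beta).
Proof.
split; [exact: fill_sum_embed | exact: fill_sum_degree_le |].
by move=> A w a b pos_a neg_b lt_ab wab adj; apply: fill_sum_cancel.
Qed.

End FillingSumSupersymmetric.

Section SuperPowerSums.
Variable K : comNzRingType.
Implicit Types (A : alphabet) (c : seq (K * seq nat)).

(* The plethystic power sum p_m, where a negative letter of weight w stands
   for the formal difference 0 - (- w). *)
Definition super_psum A (w : A -> K) (m : nat) : K :=
  \sum_x (if negative x then - (- w x) ^+ m else w x ^+ m).

Definition super_psum_comb c A (w : A -> K) : K :=
  \sum_(x <- c) x.1 * \prod_(m <- x.2) super_psum w m.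

Lemma super_psum_embed (A B : alphabet) (e : A -> B)
    (wA : A -> K) (wB : B -> K) m :
  (0 < m)%N -> injective e -> {mono e : x / negative x} ->
  (forall x, wB (e x) = wA x) -> (forall z, z \notin codom e -> wB z = 0) ->
  super_psum wB m = super_psum wA m.
Proof.
move=> m_gt0 e_inj e_neg wE w_out.
rewrite /super_psum (bigID (mem (e @: [set: A]))) /= [X in _ + X]big1 ?addr0.
  rewrite big_imset /=; last by move=> z z' _ _; apply: e_inj.
  by apply: eq_big => [x|x _]; rewrite ?inE // e_neg wE.
move=> z ze; rewrite w_out ?oppr0 ?expr0n ?(gtn_eqF m_gt0) ?oppr0 ?if_same //.
by apply: contra ze => /codomP[x ->]; apply: imset_f.
Qed.

Lemma super_psum_cancel A (w : A -> K) (a b : A) m :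
  ~~ negative a -> negative b -> w a = - w b ->
  super_psum w m = super_psum (zero_on w [set a; b]) m.
Proof.
move=> pos_a neg_b wab; have neq_ba : b != a by apply: contraNneq pos_a => <-.
rewrite /super_psum [LHS](bigD1 a) //= [RHS](bigD1 a) //=.
rewrite [X in _ + X](bigD1 b) //= [in RHS](bigD1 b) //= !addrA.
rewrite (negPf pos_a) neg_b.
rewrite /zero_on !inE !eqxx orbT /= oppr0 wab subrr addrN !add0r.
by apply: eq_bigr => y /andP[/negPf ya /negPf yb]; rewrite !inE ya yb.
Qed.

Variables (c : seq (K * seq nat)) (d : nat).
Hypothesis reg2 : GRing.lreg (2%:R : K).
Hypothesis c_size : all (fun x => size x.2 <= d)%N c.
Hypothesis c_pos : all (fun x => all (fun m => 0 < m)%N x.2) c.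

Lemma super_psum_comb_degree_le : degree_le d (super_psum_comb c).
Proof.
move=> A w X ltX; under eq_bigr do rewrite mulr_sumr.
rewrite exchange_big big_seq; apply: big1 => x /(allP c_size) szx /=.
under eq_bigr do rewrite mulrCA; rewrite -mulr_sumr.
pose g (i : 'I_(size x.2)) (y : A) (z : K) :=
  if negative y then - (- z) ^+ nth 0%N x.2 i else z ^+ nth 0%N x.2 i.
rewrite [X in _ * X](_ : _ = 0) ?mulr0 //.
have ltX' : (#|'I_(size x.2)| < #|X|)%N by rewrite card_ord (leq_ltn_trans szx).
rewrite -[RHS](sum_zero_on_eq0 (fun=> 1) g w reg2 ltX').
apply: eq_bigr => S _; congr (_ * _).
rewrite (big_nth 0%N) big_mkord bigA_distr_bigA /=.
by apply: eq_bigr => f _; rewrite mul1r.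
Qed.

Lemma super_psum_comb_supersymmetric : supersymmetric d (super_psum_comb c).
Proof.
split=> [A B e wA wB e_mono e_neg wE w_out||A w a b pos_a neg_b _ wab _].
- rewrite /super_psum_comb big_seq [RHS]big_seq; apply: eq_bigr => x.
  move=> /(allP c_pos)/allP x_pos; congr (_ * _).
  rewrite big_seq [RHS]big_seq; apply: eq_bigr => m /x_pos m_gt0.
  exact: super_psum_embed (rank_mono_inj e_mono) e_neg wE w_out.
- exact: super_psum_comb_degree_le.
apply: eq_bigr => x _; congr (_ * _); apply: eq_bigr => m _.
exact: super_psum_cancel.
Qed.

End SuperPowerSums.

(** * Power-sum and monomial expansions *)

Lemma Qqt_natr_eq0 n : (n%:R == 0 :> Qqt) = (n == 0)%N.
Proof.
rewrite -(rmorph_nat (@FracField.tofrac {mpoly rat[2]})) tofrac_eq0.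
by rewrite -mpolyC_nat mpolyC_eq0 Num.Theory.pnatr_eq0.
Qed.

Lemma mpoly_Qqt_lreg2 N : GRing.lreg (2%:R : {mpoly Qqt[N]}).
Proof. by apply: mulfI; rewrite -mpolyC_nat mpolyC_eq0 Qqt_natr_eq0. Qed.

Lemma geq_trans : transitive geq.
Proof. by move=> a b c ba ac; apply: leq_trans ac ba. Qed.

Lemma geq_total : total geq.
Proof. by move=> a b; apply: leq_total. Qed.

Section Symmetrization.
Variables (N : nat) (R : comNzRingType).
Implicit Types (f g : {mpoly R[N]}) (m : 'X_{1..N}).

Definition symmetrize f : {mpoly R[N]} := \sum_(s : 'S_N) msym s f.

Lemma symmetrizeZ c f : symmetrize (c *: f) = c *: symmetrize f.
Proof. by rewrite scaler_sumr; apply: eq_bigr => s _; rewrite msymZ. Qed.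

Lemma symmetrize_sum (J : Type) (r : seq J) (P : pred J)
    (F : J -> {mpoly R[N]}) :
  symmetrize (\sum_(j <- r | P j) F j) = \sum_(j <- r | P j) symmetrize (F j).
Proof. by rewrite exchange_big; apply: eq_bigr => s _; rewrite raddf_sum. Qed.

Lemma symmetrize_msym p f : symmetrize (msym p f) = symmetrize f.
Proof.
rewrite [RHS](reindex_inj (mulgI p)); apply: eq_bigr => s _.
by rewrite msymMm.
Qed.

Lemma symmetrize_sym f : f \is symmetric -> symmetrize f = f *+ N`!.
Proof.
move=> /issymP f_sym; rewrite /symmetrize (eq_bigr (fun=> f)) => [|s _] //.
by rewrite sumr_const card_Sn.
Qed.

Lemma mulr_symmetrize g f :
  g \is symmetric -> g * symmetrize f = symmetrize (g * f).
Proof.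
move=> /issymP g_sym; rewrite mulr_sumr; apply: eq_bigr => s _.
by rewrite msymM g_sym.
Qed.

Lemma symmetrize_addU m (i j : 'I_N) a : m i = 0%N -> m j = 0%N ->
  symmetrize 'X_[m + U_(j) *+ a] = symmetrize 'X_[m + U_(i) *+ a].
Proof.
move=> mi mj; rewrite -(symmetrize_msym (tperm i j) 'X_[m + U_(i) *+ a]) msymX.
congr (symmetrize 'X_[_]); apply/mnmP => k.
rewrite tpermV mnmE !mnmDE !mulmnE !mnm1E.
case: tpermP => [->|->|/eqP ki /eqP kj]; first by rewrite mi mj eq_sym.
  by rewrite mi mj !eqxx.
by rewrite !(eq_sym _ k) (negPf ki) (negPf kj).
Qed.

End Symmetrization.

Section PowerSumExpansion.
Variable N : nat.
Implicit Types (f g : {mpoly Qqt[N]}) (m : 'X_{1..N}).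

Lemma sym_psum a : psum N a \is symmetric.
Proof.
apply/issymP => s; rewrite /psum rmorph_sum [RHS](reindex_inj (@perm_inj _ s)).
by apply: eq_bigr => i _; rewrite rmorphXn /= /msym mmapX mmap1U.
Qed.

Lemma psum_mulX a m : psum N a * 'X_[m] = \sum_j 'X_[m + U_(j) *+ a].
Proof.
rewrite mulr_suml; apply: eq_bigr => j _.
by rewrite mpolyXD -mpolyXn mulrC.
Qed.

Definition psum_spanned (d : nat) f : Prop := exists s, psum_expansion d s f.

Lemma psum_spanned0 d : psum_spanned d 0.
Proof. by exists [::]; split; rewrite // big_nil. Qed.

Lemma psum_spannedD d f g :
  psum_spanned d f -> psum_spanned d g -> psum_spanned d (f + g).
Proof.
case=> s [ps ->] [s' [ps' ->]]; exists (s ++ s').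
by rewrite /psum_expansion all_cat ps big_cat.
Qed.

Lemma psum_spannedZ d c f : psum_spanned d f -> psum_spanned d (c *: f).
Proof.
case=> s [ps ->]; exists [seq (c * x.1, x.2) | x <- s]; split.
  by rewrite all_map; apply: sub_all ps.
by rewrite big_map scaler_sumr; apply: eq_bigr => x _; rewrite scalerA.
Qed.

Lemma psum_spanned_sum d (J : Type) (r : seq J) (P : pred J)
    (F : J -> {mpoly Qqt[N]}) :
  (forall i, P i -> psum_spanned d (F i)) ->
  psum_spanned d (\sum_(i <- r | P i) F i).
Proof.
move=> spanned; apply: big_ind => //; first exact: psum_spanned0.
exact: psum_spannedD.
Qed.

Lemma psum_spannedM d a f : (0 < a)%N ->
  psum_spanned d f -> psum_spanned (a + d) (psum N a * f).
Proof.
move=> a0 [s [/allP ps ->]]; exists [seq (x.1, sort geq (a :: x.2)) | x <- s].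
have pe mu : perm_eq (sort geq (a :: mu)) (a :: mu) by rewrite perm_sort.
split.
  rewrite all_map; apply/allP => x /ps /andP[/andP[_ x_pos] /eqP x_sum] /=.
  rewrite /is_partition_of /is_partition sort_sorted; last exact: geq_total.
  by rewrite (perm_all _ (pe _)) /= a0 x_pos (perm_sumn (pe _)) /= x_sum /=.
rewrite big_map mulr_sumr; apply: eq_bigr => x _ /=.
by rewrite -scalerAr /psum_part (perm_big _ (pe _)) big_cons.
Qed.

(* Multiplying a monomial m that omits x_i by p_a produces, besides the
   monomials equivalent to m x_i^a, only monomials in the variables of m. *)
Lemma psum_mul_symmetrizeX a m (i : 'I_N) : m i = 0%N ->
  psum N a * symmetrize 'X_[m] =
  symmetrize 'X_[m + U_(i) *+ a] *+ #|[pred j | m j == 0%N]| +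
  \sum_(j | m j != 0%N) symmetrize 'X_[m + U_(j) *+ a].
Proof.
move=> mi; rewrite mulr_symmetrize ?sym_psum // psum_mulX symmetrize_sum.
rewrite (bigID (fun j => m j == 0%N)) /=; congr (_ + _).
rewrite -sumr_const; apply: eq_bigr => j /eqP mj; exact: symmetrize_addU.
Qed.

Definition erase m (i : 'I_N) : 'X_{1..N} :=
  [multinom if j == i then 0%N else m j | j < N].

Lemma erase_add m i : m = (erase m i + U_(i) *+ m i)%MM.
Proof.
apply/mnmP => j; rewrite mnmDE mulmnE mnm1E mnmE.
by case: (eqVneq j i) => [->|_]; rewrite ?mul1n ?add0n ?addn0.
Qed.

Lemma mdeg_addU m (j : 'I_N) a : mdeg (m + U_(j) *+ a) = (a + mdeg m)%N.
Proof. by rewrite mdegD mdegMn mdeg1 mul1n addnC. Qed.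

Definition mvars m : {set 'I_N} := [set i | m i != 0%N].

Lemma mvars_erase m i : i \in mvars m -> mvars (erase m i) \proper mvars m.
Proof.
move=> im; apply/properP; split; last by exists i; rewrite // inE mnmE !eqxx.
by apply/subsetP => j; rewrite !inE mnmE; case: (j == i).
Qed.

Lemma mvars_addU m j a : m j != 0%N -> mvars (m + U_(j) *+ a) = mvars m.
Proof.
move=> mj; apply/setP => i; rewrite !inE mnmDE mulmnE mnm1E.
case: (eqVneq j i) => [<-|_].
  by rewrite addn_eq0 negb_and mj.
by rewrite mul0n addn0.
Qed.

Lemma psum_spanned_symmetrizeX m : psum_spanned (mdeg m) (symmetrize 'X_[m]).
Proof.
have [n] := ubnP #|mvars m|; elim: n m => // n IHn m; rewrite ltnS => le_n.
case: (set_0Vmem (mvars m)) => [no_var|[i im]].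
  have -> : m = 0%MM.
    apply/mnmP => i; rewrite mnm0E; apply/eqP/negbFE.
    by move/setP/(_ i): no_var; rewrite !inE.
  rewrite mpolyX0 symmetrize_sym ?rpred1 // mdeg0; exists [:: ((N`!)%:R, [::])].
  by split; rewrite // big_seq1 /psum_part big_nil scaler_nat.
set m0 := erase m i.
have lt_m0 := leq_trans (proper_card (mvars_erase im)) le_n.
have m0i : m0 i = 0%N by rewrite mnmE eqxx.
have := psum_mul_symmetrizeX (m i) m0i; rewrite -erase_add; set absent := #|_|.
have absent_neq0 : absent%:R != 0 :> Qqt.
  by rewrite Qqt_natr_eq0 -lt0n; apply/card_gt0P; exists i; rewrite inE m0i.
move/(congr1 (fun f => absent%:R^-1 *: f)); rewrite scalerDr -scaler_nat.
rewrite scalerK // => /eqP; rewrite -subr_eq => /eqP <-.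
have -> : mdeg m = (m i + mdeg m0)%N by rewrite {1}(erase_add m i) mdeg_addU.
apply: psum_spannedD; last rewrite -scaleN1r; do ?apply: psum_spannedZ.
  by apply: psum_spannedM; [move: im; rewrite inE lt0n | apply: IHn].
apply: psum_spanned_sum => j m0j; rewrite -(mdeg_addU m0 j); apply: IHn.
by rewrite mvars_addU.
Qed.

Lemma sym_psum_spanned d f :
  f \is symmetric -> f \is d.-homog -> psum_spanned d f.
Proof.
move=> f_sym /dhomogP f_homog.
have fact_neq0 : (N`!)%:R != 0 :> Qqt by rewrite Qqt_natr_eq0 -lt0n fact_gt0.
have -> : f = (N`!)%:R^-1 *: \sum_(m <- msupp f) f@_m *: symmetrize 'X_[m].
  rewrite -[LHS](scalerK fact_neq0) scaler_nat -symmetrize_sym //.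
  rewrite {1}(mpolyE f) symmetrize_sum; congr (_ *: _).
  by apply: eq_bigr => m _; rewrite symmetrizeZ.
apply: psum_spannedZ; rewrite big_seq; apply: psum_spanned_sum => m /f_homog <-.
by apply: psum_spannedZ; apply: psum_spanned_symmetrizeX.
Qed.

End PowerSumExpansion.

Lemma perm_eq_filter_predC1 (T : eqType) (x0 : T) (s s' : seq T) :
  size s = size s' ->
  perm_eq [seq x <- s | x != x0] [seq x <- s' | x != x0] -> perm_eq s s'.
Proof.
move=> eq_size /seq.permP eq_count; apply/seq.permP => a.
have count_split (r : seq T) : count a r =
    (count a [seq x <- r | x != x0] +
     a x0 * (size r - size [seq x <- r | x != x0]))%N.
  rewrite size_filter -(count_predC (predC1 x0) r) addKn.
  elim: r => [|x r /= ->]; first by rewrite muln0.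
  by case: (eqVneq x x0) => [->|_] /=; case: (a x0); lia.
have eq_sz : size [seq x <- s | x != x0] = size [seq x <- s' | x != x0].
  by rewrite -!(count_predT [seq _ <- _ | _]).
by rewrite (count_split s) (count_split s') eq_size eq_count eq_sz.
Qed.

Section MonomialExpansion.
Variable N : nat.
Implicit Types (f : {mpoly Qqt[N]}) (m : 'X_{1..N}).

Definition mpart m : seq nat :=
  sort geq [seq x <- [seq m i | i <- enum 'I_N] | (0 < x)%N].

Lemma perm_mpart m :
  perm_eq (mpart m) [seq x <- [seq m i | i <- enum 'I_N] | (0 < x)%N].
Proof. by rewrite perm_sort. Qed.

Lemma sumn_mpart m : sumn (mpart m) = mdeg m.
Proof.
rewrite (perm_sumn (perm_mpart m)) sumnE big_filter big_map big_enum_cond mdegE.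
by rewrite big_mkcond; apply: eq_bigr => i _; case: posnP.
Qed.

Lemma is_partition_mpart m : is_partition_of (mdeg m) (mpart m).
Proof.
rewrite /is_partition_of sumn_mpart eqxx andbT /is_partition.
by rewrite sort_sorted ?all_sort ?filter_all //; apply: geq_total.
Qed.

Lemma sumn_take_mpart m i :
  exists2 J : {set 'I_N}, (#|J| <= i)%N &
    sumn (take i (mpart m)) = (\sum_(j in J) m j)%N.
Proof.
pose r := sort (relpre m geq) [seq j <- enum 'I_N | (0 < m j)%N].
have r_uniq : uniq (take i r).
  by rewrite take_uniq // sort_uniq filter_uniq ?enum_uniq.
exists [set j in take i r].
  by rewrite cardsE (card_uniqP r_uniq) size_take_min geq_minl.
rewrite /mpart filter_map sort_map -map_take sumnE big_map (big_uniq _ r_uniq).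
by apply: eq_bigl => j; rewrite inE.
Qed.

Lemma mpart_eq_perm m m' : mpart m = mpart m' ->
  exists s : 'S_N, m' = [multinom m (s i) | i < N].
Proof.
move=> eq_part; pose val_tuple (m0 : 'X_{1..N}) := [tuple m0 i | i < N].
have pe m0 : perm_eq (mpart m0) [seq x <- val_tuple m0 | x != 0%N].
  by rewrite /mpart perm_sort (eq_filter lt0n) /= enumT.
have /tuple_permP[s sE] : perm_eq (val_tuple m') (val_tuple m).
  apply: (@perm_eq_filter_predC1 _ 0%N); first by rewrite !size_tuple.
  by rewrite -(permPl (pe m')) -eq_part.
exists s; apply/mnmP => i; rewrite mnmE.
have := congr1 (fun r => nth 0%N r i) sE; rewrite -!tnth_nth /=.
by rewrite !tnth_mktuple.
Qed.

Lemma mcoeff_msym_part (mu : seq nat) m :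
  (msym_part N mu)@_m = (mpart m == mu)%:R.
Proof.
rewrite /msym_part raddf_sum /=; under eq_bigr do rewrite mcoeffX.
case: (eqVneq (mpart m) mu) => [e|ne].
  have dm : (mdeg m < (sumn mu).+1)%N by rewrite -e sumn_mpart.
  rewrite (bigD1 (BMultinom dm)) /=; last by rewrite -e.
  rewrite eqxx big1 ?addr0 // => m' /andP[_]; rewrite -val_eqE /=.
  by move/negPf->.
apply: big1 => m' /eqP e; case: eqP => // m'm; case/eqP: ne.
by rewrite -e -m'm.
Qed.

Lemma mcoeff_eq_mpart f m m' :
  f \is symmetric -> mpart m = mpart m' -> f@_m = f@_m'.
Proof. by move=> f_sym /mpart_eq_perm[s ->]; rewrite msym_coeff. Qed.

Lemma sym_msym_part_expansion f : f \is symmetric ->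
  exists c : seq (Qqt * seq nat),
    {in c, forall x, exists2 m, m \in msupp f & x.2 = mpart m} /\
    f = \sum_(x <- c) x.1 *: msym_part N x.2.
Proof.
move=> f_sym; pose P := [seq mpart m | m <- msupp f].
pose coef mu := f@_(nth 0%MM (msupp f) (index mu P)).
have coefE m : mpart m \in P -> coef (mpart m) = f@_m.
  move=> mP; apply: mcoeff_eq_mpart => //.
  by rewrite -(nth_map 0%MM [::]) ?nth_index // -(size_map mpart) index_mem.
exists [seq (coef mu, mu) | mu <- undup P]; split=> [x /mapP[mu]|].
  by rewrite mem_undup => /mapP[m ms ->] ->; exists m.
rewrite big_map; apply/mpolyP => m; rewrite raddf_sum /=.
under eq_bigr do rewrite mcoeffZ mcoeff_msym_part.
have [mP|mP] := boolP (mpart m \in P); last first.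
  rewrite big_seq big1 => [|mu].
    by apply/eqP; rewrite mcoeff_eq0; apply: contra mP => ?; apply: map_f.
  rewrite mem_undup => muP; rewrite [_ == _](contraNF _ mP) ?mulr0 //.
  by move/eqP->.
rewrite (bigD1_seq (mpart m)) ?mem_undup ?undup_uniq //= eqxx mulr1 coefE //.
by rewrite big1 ?addr0 // => mu; rewrite eq_sym => /negPf ->; rewrite mulr0.
Qed.

Lemma sym_pleth_tm1 s : pleth_tm1 N s \is symmetric.
Proof.
apply: rpred_sum => x _; apply: rpredZ; apply: rpred_prod => m _.
exact: sym_psum.
Qed.

End MonomialExpansion.

(** * Cells, letters and statistics *)

Section Diagram.
Variable la : seq nat.
Local Notation H := (head 0%N la).
Local Notation k := (size la).

Definition dg : {pred 'I_H * 'I_k} :=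
  [pred c : 'I_H * 'I_k | in_dg la c.1.+1 c.2.+1].

(* Rows and columns of cells are numbered from 0. *)
Definition cell : finType := {c : 'I_H * 'I_k | c \in dg}.
Definition row (c : cell) : nat := (val c).1.
Definition col (c : cell) : nat := (val c).2.
Implicit Types (u v c : cell).

Lemma cellP c : in_dg la (row c).+1 (col c).+1.
Proof. exact: (valP c). Qed.

Lemma in_dgE r i : in_dg la r.+1 i.+1 = (i < k)%N && (r < nth 0%N la i)%N.
Proof. by []. Qed.

Lemma ltn_row c : (row c < H)%N. Proof. exact: ltn_ord. Qed.

Lemma ltn_col c : (col c < k)%N. Proof. exact: ltn_ord. Qed.

Lemma cell_inj c c' : row c = row c' -> col c = col c' -> c = c'.
Proof.
move=> er ec; apply: val_inj; move: er ec; rewrite /row /col.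
by case: (val c) (val c') => [a b] [a' b'] /= /val_inj -> /val_inj ->.
Qed.

Lemma big_cell (R : Type) (idx : R) (op : Monoid.com_law idx)
    (F : nat -> nat -> R) :
  \big[op/idx]_(c : cell) F (row c) (col c) =
  \big[op/idx]_(i < k) \big[op/idx]_(r < H | in_dg la r.+1 i.+1) F r i.
Proof.
rewrite -(big_sub dg (fun c : 'I_H * 'I_k => F c.1 c.2)).
by rewrite [RHS](exchange_big_dep xpredT) //= pair_big_dep.
Qed.

Definition attacks v u : bool :=
  ((row v == row u) && (col v < col u)%N) ||
  ((row u == (row v).+1) && (col u < col v)%N).

Definition just_below v u : bool := (row u == (row v).+1) && (col u == col v).

Definition right_of v u : bool := (row u == row v) && (col v < col u)%N.

Definition arm v : nat := \sum_u right_of v u.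

Definition cell_wt v u : Qqt :=
  if attacks v u then tt_
  else if just_below v u then
    qq ^+ (leg la (row u).+1 (col u).+1).+1 / tt_ ^+ arm v
  else 1.

Definition reading_index c : nat := (row c * k + col c)%N.

Lemma attacks_just_belowF v u : attacks v u -> just_below v u = false.
Proof.
rewrite /attacks /just_below.
by move: (row v) (row u) (col v) (col u) => rv ru cv cu; lia.
Qed.

Lemma reading_index_inj : injective reading_index.
Proof.
move=> c c'; rewrite /reading_index => E.
have [lt lt'] := (ltn_col c, ltn_col c').
have k_gt0 : (0 < k)%N by apply: leq_trans lt.
apply: cell_inj.
  by have := congr1 (divn^~ k) E; rewrite /= !divnMDl // !divn_small // !addn0.
by have := congr1 (modn^~ k) E; rewrite /= !modnMDl !modn_small.
Qed.

Lemma reading_index_lt v u : (reading_index v < reading_index u)%N =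
  (row v < row u)%N || ((row v == row u) && (col v < col u)%N).
Proof.
rewrite /reading_index; have [lt lt'] := (ltn_col v, ltn_col u).
case: (ltngtP (row v) (row u)) => [ltr|gtr|->] /=; last by rewrite ltn_add2l.
- by have := leq_mul2r k (row v).+1 (row u); rewrite ltr orbT mulSn; lia.
- by have := leq_mul2r k (row u).+1 (row v); rewrite gtr orbT mulSn; lia.
Qed.

Lemma cell_wt_neq1 v u : cell_wt v u != 1 -> attacks v u || just_below v u.
Proof.
by rewrite /cell_wt; case: attacks => //; case: just_below => //; rewrite eqxx.
Qed.

Lemma attacks_reading_index v u : attacks v u || just_below v u ->
  (reading_index v < reading_index u)%N.
Proof.
rewrite reading_index_lt /attacks /just_below.
by move: (row v) (row u) (col v) (col u) => rv ru cv cu; lia.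
Qed.

(* In reading order, the cells from v to a cell that v attacks, or to the cell
   above v, lie in two successive rows, on either side of a column. *)
Lemma attacks_nested v u v' u' :
  attacks v u || just_below v u -> (v', u') != (v, u) ->
  (reading_index v <= reading_index v')%N ->
  (reading_index v' < reading_index u')%N ->
  (reading_index u' <= reading_index u)%N -> attacks v' u'.
Proof.
move=> vu ne; rewrite (leqNgt (reading_index v)) (leqNgt (reading_index u')).
rewrite !reading_index_lt => le_v lt_vu le_u.
have ne_pos : ~ (row v' = row v /\ col v' = col v /\
                 row u' = row u /\ col u' = col u).
  case=> rv [cv [ru cu]]; case/eqP: ne.
  by rewrite (cell_inj rv cv) (cell_inj ru cu).
move: vu ne_pos le_v lt_vu le_u; rewrite /attacks /just_below.
move: (row v) (row u) (col v) (col u) (row v') (row u') (col v') (col u').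
by clear; lia.
Qed.

Section PartitionShape.
Hypothesis pla : is_partition la.

Lemma partition_nth_le i j : (i <= j)%N -> (nth 0%N la j <= nth 0%N la i)%N.
Proof.
move=> le_ij; have [jk|jk] := ltnP j k; last by rewrite nth_default.
case/andP: pla => la_sorted _.
apply: (sorted_leq_nth geq_trans leqnn 0%N la_sorted); rewrite ?inE //.
exact: leq_ltn_trans le_ij jk.
Qed.

Lemma partition_nth_le_head i : (nth 0%N la i <= H)%N.
Proof. by rewrite -nth0 partition_nth_le. Qed.

Lemma cell_exists r i : in_dg la r.+1 i.+1 ->
  exists c : cell, row c = r /\ col c = i.
Proof.
move=> ri; have := ri; rewrite in_dgE => /andP[ik rl].
have rH : (r < H)%N by apply: leq_trans rl (partition_nth_le_head i).
by exists (exist _ (Ordinal rH, Ordinal ik) ri : cell).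
Qed.

Lemma card_cell : #|cell| = sumn la.
Proof.
rewrite -sum1_card (@big_cell _ _ _ (fun _ _ => 1%N)).
rewrite sumnE (big_nth 0%N) big_mkord.
apply: eq_bigr => i _; rewrite -[RHS]card_ord -sum1_card.
rewrite (big_ord_widen H (fun=> 1%N)); last exact: partition_nth_le_head.
by apply: eq_bigl => r; rewrite in_dgE ltn_ord.
Qed.

Lemma sum_just_below u (f : cell -> nat) (n : nat) :
  (forall v, just_below v u -> f v = n) ->
  (\sum_v just_below v u * f v = (0 < row u) * n)%N.
Proof.
move=> fn; case ru: (row u) => [|r].
  by rewrite big1 // => v _; rewrite /just_below ru.
have [|v [vr vc]] := @cell_exists r (col u).
  by have := cellP u; rewrite !in_dgE ru => /andP[-> /ltnW].
have vu : just_below v u by rewrite /just_below ru vr vc !eqxx.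
rewrite (bigD1 v) //= vu fn // big1 ?addn0 // => v' /eqP nv.
case: (boolP (just_below v' u)) => // /andP[/eqP r' /eqP c']; case: nv.
by apply: cell_inj; [move: r'; rewrite ru vr => -[] | rewrite vc].
Qed.

Lemma sum_just_above v (f : nat -> nat -> nat) :
  (forall r i, ~~ in_dg la r i -> f r i = 0%N) ->
  (\sum_u just_below v u * f (row u).+1 (col u).+1 = f (row v).+2 (col v).+1)%N.
Proof.
move=> f_out; have [above|no_above] := boolP (in_dg la (row v).+2 (col v).+1).
  have [u [ur uc]] := cell_exists above.
  have vu : just_below v u by rewrite /just_below ur uc !eqxx.
  rewrite (bigD1 u) //= vu ur uc mul1n big1 ?addn0 // => u' /eqP nu.
  case: (boolP (just_below v u')) => // /andP[/eqP r' /eqP c']; case: nu.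
  by apply: cell_inj; rewrite ?r' ?c' ?ur ?uc.
rewrite f_out // big1 // => u _.
case: (boolP (just_below v u)) => // /andP[/eqP ur /eqP uc].
by have := cellP u; rewrite ur uc (negPf no_above).
Qed.

End PartitionShape.
End Diagram.

Lemma tt_neq0 : tt_ != 0.
Proof. by rewrite /tt_ tofrac_eq0 -msupp_eq0 msuppX. Qed.

Lemma letter_rank_inj N :
  injective (fun x : 'I_N * bool => x.1.*2 + x.2)%N.
Proof.
move=> [j b] [j' b'] /= E.
have eq_b : b = b' by have := congr1 odd E; rewrite !oddD !odd_double !oddb.
by move: E; rewrite eq_b => /addIn/double_inj/val_inj ->.
Qed.

Definition letter_alphabet (N : nat) : alphabet :=
  @Alphabet ('I_N * bool)%type _ snd (@letter_rank_inj N).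

Lemma super_gt_letterE N (x y : letter_alphabet N) :
  super_gt x y = (y.1 < x.1)%N || ((x.1 == y.1) && x.2).
Proof.
case: x y => [j b] [j' b']; rewrite /super_gt /= xpair_eqE -val_eqE /=.
by case: ltngtP; case: b; case: b' => //=; lia.
Qed.

Section Fillings.
Variables (la : seq nat) (N : nat).
Hypothesis pla : is_partition la.
Local Notation cell := (cell la).
Local Notation filling := {ffun cell -> letter_alphabet N}.

Definition grid_of (s : filling) : gridT la N := [ffun c => omap s (insub c)].

Lemma grid_of_val s (c : cell) : grid_of s (val c) = Some (s c).
Proof. by rewrite ffunE valK. Qed.

Lemma grid_of_out s c : c \notin @dg la -> grid_of s c = None.
Proof. by move=> cd; rewrite ffunE insubN. Qed.

Lemma is_filling_grid_of s : is_filling (grid_of s).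
Proof.
apply/forallP => c; have [cd|cd] := boolP (c \in @dg la).
  by rewrite (grid_of_val s (exist _ c cd : cell)) eq_sym; apply/eqP.
by rewrite grid_of_out // eq_sym; apply/eqP/negbTE.
Qed.

Lemma grid_of_inj : injective grid_of.
Proof.
move=> s s' e; apply/ffunP => c.
by apply: Some_inj; rewrite -!grid_of_val e.
Qed.

Lemma grid_of_surj (F : gridT la N) : is_filling F -> exists s, F = grid_of s.
Proof.
move=> /forallP F_filling.
have /fin_all_exists[s sE] (c : cell) : exists x, F (val c) = Some x.
  have := F_filling (val c); rewrite [in_dg _ _ _](valP c).
  by case: (F _) => // x _; exists x.
exists [ffun c => s c]; apply/ffunP => c; have [cd|cd] := boolP (c \in @dg la).
  by rewrite (grid_of_val _ (exist _ c cd : cell)) ffunE -sE.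
rewrite grid_of_out //; have := F_filling c; rewrite [in_dg _ _ _](negbTE cd).
by case: (F c).
Qed.

Lemma sum_fillings (V : nmodType) (P : pred (gridT la N))
    (G : gridT la N -> V) :
  \sum_(F | is_filling F && P F) G F = \sum_(s | P (grid_of s)) G (grid_of s).
Proof.
rewrite (eq_bigl (fun F => (F \in grid_of @: [set: filling]) && P F)) => [|F].
  rewrite big_imset_cond /=; last by move=> s s' _ _; apply: grid_of_inj.
  by apply: eq_bigl => s; rewrite inE.
congr (_ && _); apply/idP/imsetP => [/grid_of_surj[s ->]|[s _ ->]].
  by exists s; rewrite ?inE.
exact: is_filling_grid_of.
Qed.

Lemma big_grid_of (R : Type) (idx : R) (op : Monoid.com_law idx)
    (g : option ('I_N * bool) -> R) (s : filling) : g None = idx ->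
  \big[op/idx]_c g (grid_of s c) = \big[op/idx]_(c : cell) g (Some (s c)).
Proof.
move=> g0; rewrite (bigID (mem (@dg la))) /= [X in op _ X]big1 ?Monoid.mulm1.
  by rewrite (big_sub (@dg la)); apply: eq_bigr => c _; rewrite grid_of_val.
by move=> c cd; rewrite grid_of_out.
Qed.

Lemma entry_grid_of s (c : cell) :
  entry (grid_of s) (row c).+1 (col c).+1 = ((s c).1.+1, (s c).2).
Proof.
rewrite /entry cellP /= !valK -surjective_pairing grid_of_val.
by case: (s c).
Qed.

Lemma entry_out s r i : ~~ in_dg la r i -> entry (grid_of s) r i = zero_letter.
Proof. by rewrite /entry => /negbTE ->. Qed.

Lemma IndE a b : Ind a b = (b.1 < a.1)%N || ((a.1 == b.1) && a.2).
Proof.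
case: a b => [a sa] [b sb]; rewrite /Ind /lt1 /= xpair_eqE.
by case: (ltngtP a b) => //= _; case: sa; case: sb.
Qed.

Lemma quinv_tripleE a b c :
  (quinv_triple a b c + Ind a b = Ind c b + Ind a c)%N.
Proof.
rewrite /quinv_triple !IndE; move: a b c => [a sa] [b sb] [c sc] /=.
by case: sa; case: sb; case: sc; case: (ltngtP a b); case: (ltngtP b c);
  case: (ltngtP a c) => //=; lia.
Qed.

Section Statistics.
Variable s : filling.
Local Notation E := (entry (grid_of s)).
Local Notation at_cell c := (E (row c).+1 (col c).+1).
Local Notation above c := (E (row c).+2 (col c).+1).
Local Notation I u v := (super_gt (s u) (s v)).

Lemma Ind_cells u v : Ind (at_cell u) (at_cell v) = I u v.
Proof. by rewrite !entry_grid_of IndE super_gt_letterE /= ltnS eqSS. Qed.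

Lemma Ind_above (b c : cell) :
  (Ind (above b) (at_cell c) = \sum_a just_below b a * I a c :> nat)%N.
Proof.
rewrite -(@sum_just_above la pla b (fun r i => Ind (E r i) (at_cell c))).
  by apply: eq_bigr => a _; rewrite Ind_cells.
by move=> r i out; rewrite entry_out // IndE entry_grid_of.
Qed.

Lemma majE : maj (grid_of s) =
  (\sum_u \sum_v (just_below v u && I u v) *
     (leg la (row u).+1 (col u).+1).+1)%N.
Proof.
pose G r i :=
  ((0 < r) * (Ind (E r.+1 i.+1) (E r i.+1) * (leg la r.+1 i.+1).+1))%N.
transitivity (\sum_(u : cell) G (row u) (col u))%N; last first.
  apply: eq_bigr => u _; rewrite /G -(@sum_just_below la pla u
    (fun v => I u v * (leg la (row u).+1 (col u).+1).+1)%N).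
    by apply: eq_bigr => v _; rewrite mulnA mulnb.
  by move=> v /andP[/eqP rv /eqP cv]; rewrite -Ind_cells -cv -rv.
rewrite (@big_cell la _ _ _ G) /maj big_add1 big_mkord; apply: eq_bigr => i _.
rewrite big_add1 /= big_geq_mkord /=.
rewrite (big_ord_widen_cond (head 0%N la) (fun r => 0 < r)%N
   (fun r => if Ind (E r.+1 i.+1) (E r.+1.-1 i.+1)
             then (leg la r.+1 i.+1).+1 else 0)%N).
  rewrite [LHS]big_mkcond [RHS]big_mkcond; apply: eq_bigr => r _ /=.
  rewrite in_dgE ltn_ord /= /G /colh /=.
  case: (0 < r)%N; rewrite /= ?if_same //.
  by case: (r < _)%N => //; case: Ind; rewrite ?mul1n.
exact: partition_nth_le_head.
Qed.

Lemma quinvE : quinv (grid_of s) =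
  (\sum_(b : cell) \sum_(c : cell)
     right_of b c * quinv_triple (above b) (at_cell b) (at_cell c))%N.
Proof.
pose G r i r' j := (((r' == r) && (i < j)) *
   quinv_triple (E r.+2 i.+1) (E r.+1 i.+1) (E r'.+1 j.+1))%N.
rewrite [RHS](@big_cell la _ _ _
  (fun r i => \sum_(c : cell) G r i (row c) (col c))%N).
rewrite /quinv big_add1 big_mkord; apply: eq_bigr => i _.
rewrite big_add1 /= big_geq_mkord /=.
under [RHS]eq_bigr do rewrite (@big_cell la _ _ _ (fun r j => G _ _ r j)).
rewrite [RHS]exchange_big /= [LHS]big_mkcond /=; apply: eq_bigr => j _.
rewrite [RHS]big_mkcond /= big_add1 big_mkord; case: ifPn => ij; last first.
  rewrite big1 // => r _; case: ifP => // _; rewrite big1 // => r' _.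
  by rewrite /G (negPf ij) andbF.
apply: eq_bigr => r _; have [ri|ri] := boolP (in_dg la r.+1 i.+1) => //=.
have [rj|rj] := boolP (in_dg la r.+1 j.+1) => /=.
  rewrite (bigD1 r) //= /G eqxx ij mul1n big1 ?addn0.
    by case: ifPn => // nri; rewrite (entry_out s nri).
  by move=> r' /andP[_ nr]; rewrite val_eqE (negPf nr).
rewrite big1 // => r' rj'; rewrite /G; case: eqP => // e.
by rewrite e (negPf rj) in rj'.
Qed.

Lemma sum_Ind_above_self :
  (\sum_(b : cell) \sum_(c : cell) right_of b c * Ind (above b) (at_cell b) =
   \sum_u \sum_v (just_below v u && I u v) * arm v)%N.
Proof.
rewrite [RHS]exchange_big; apply: eq_bigr => b _.
rewrite -!big_distrl /= mulnC Ind_above; congr (_ * _)%N.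
by apply: eq_bigr => a _; rewrite mulnb.
Qed.

Lemma sum_Ind_above_right :
  (\sum_(b : cell) \sum_(c : cell) right_of b c * Ind (above b) (at_cell c) =
   \sum_u \sum_v ((row u == (row v).+1) && (col u < col v)) * I u v)%N.
Proof.
rewrite exchange_big [RHS]exchange_big; apply: eq_bigr => c _ /=.
under eq_bigr do rewrite Ind_above big_distrr /=.
rewrite exchange_big /=; apply: eq_bigr => a _.
under eq_bigr do rewrite mulnA [(_ * just_below _ _)%N]mulnC.
rewrite -big_distrl /=; congr (_ * _)%N.
rewrite (@sum_just_below la pla a _
  ((row a == (row c).+1) && (col a < col c)%N)).
  by rewrite mulnb; case: eqP => [->|]; rewrite ?andbF.
by move=> b /andP[/eqP -> /eqP ca]; rewrite /right_of eqSS eq_sym ca.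
Qed.

Lemma quinv_arm :
  (quinv (grid_of s) + \sum_u \sum_v (just_below v u && I u v) * arm v =
   \sum_u \sum_v (attacks v u && I u v))%N.
Proof.
rewrite -sum_Ind_above_self quinvE -big_split /=.
under eq_bigr => b _.
  rewrite -big_split /=.
  under eq_bigr do rewrite -mulnDr quinv_tripleE mulnDr.
  rewrite big_split /=.
  over.
rewrite big_split /= sum_Ind_above_right exchange_big -big_split.
apply: eq_bigr => u _; rewrite -big_split; apply: eq_bigr => v _ /=.
rewrite Ind_cells /attacks /right_of.
move: (super_gt _ _) (row v) (row u) (col v) (col u) => [] rv ru cv cu; lia.
Qed.

Lemma stat_fill_wt :
  qq ^+ maj (grid_of s) * tt_ ^+ quinv (grid_of s) = fill_wt (@cell_wt la) s.
Proof.
set arms := (\sum_u \sum_v (just_below v u && I u v) * arm v)%N.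
apply: (@mulIf _ (tt_ ^+ arms)); first by rewrite expf_neq0 // tt_neq0.
rewrite -mulrA -exprD quinv_arm majE /arms !expr_sum -!big_split.
apply: eq_bigr => u _; rewrite !expr_sum -!big_split; apply: eq_bigr => v _ /=.
rewrite /cell_wt; case: (super_gt _ _); last first.
  by rewrite !andbF !mul0n !expr0 !mulr1.
rewrite !andbT; have [att|_] := boolP (attacks v u).
  by rewrite attacks_just_belowF // !mul0n !expr0 mulr1 mul1r expr1.
case: just_below; rewrite ?mul0n ?mul1n ?expr0 ?mulr1 //.
by rewrite divfK // expf_neq0 // tt_neq0.
Qed.

End Statistics.
End Fillings.

(** * Non-attacking fillings *)

Section MacdonaldSums.
Variables (la : seq nat) (N : nat).
Hypothesis pla : is_partition la.
Local Notation cell := (cell la).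
Local Notation letter := (letter_alphabet N).
Local Notation filling := {ffun cell -> letter}.
Local Notation K := {mpoly Qqt[N]}.

Definition mcell_wt (v u : cell) : K := (cell_wt v u)%:MP.

Lemma mcell_wt_neq1 v u : mcell_wt v u != 1 -> attacks v u || just_below v u.
Proof.
move=> wvu; apply: cell_wt_neq1; apply: contraNneq wvu => e.
by rewrite /mcell_wt e.
Qed.

Lemma mcell_wt_reading_index v u :
  mcell_wt v u != 1 -> (reading_index v < reading_index u)%N.
Proof. by move/mcell_wt_neq1/attacks_reading_index. Qed.

Lemma mcell_wt_nested : nested (@reading_index la) tt_%:MP [set: cell] mcell_wt.
Proof.
move=> v u _ _ wvu; split; first exact: mcell_wt_reading_index.
move=> v' u' _ _ ne le_v lt_vu le_u; rewrite /mcell_wt /cell_wt.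
by rewrite (attacks_nested (mcell_wt_neq1 wvu) ne le_v lt_vu le_u).
Qed.

Lemma fill_wt_mcell_wt (s : filling) :
  fill_wt mcell_wt s = (fill_wt (@cell_wt la) s)%:MP.
Proof. by rewrite (fill_wt_rmorph (@mpolyC N Qqt)). Qed.

Definition content (s : filling) : 'X_{1..N} :=
  (\sum_(c : cell) U_((s c).1))%MM.

Lemma prod_cells_content (s : filling) :
  \prod_(c : cell) 'X_((s c).1) = 'X_[content s] :> K.
Proof.
by rewrite /content (big_morph (fun m => 'X_[m]) (@mpolyXD _ _) (@mpolyX0 _ _)).
Qed.

Lemma mdeg_content s : mdeg (content s) = sumn la.
Proof.
rewrite /content mdeg_sum (eq_bigr (fun=> 1%N)) => [|c _].
  by rewrite sum1_card card_cell.
exact: mdeg1.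
Qed.

Lemma contentE s j : content s j = #|[set c : cell | (s c).1 == j]|.
Proof.
rewrite /content mnm_sumE -sum1_card [RHS]big_mkcond; apply: eq_bigr => c _.
by rewrite mnm1E inE; case: eqP.
Qed.

Lemma xmon_grid_of (s : filling) : xmon (grid_of s) = 'X_[content s].
Proof.
rewrite -prod_cells_content /xmon.
rewrite (@big_grid_of _ _ _ _ _
  (fun o => if o is Some (j, _) then 'X_j else 1)) //.
by apply: eq_bigr => c _; case: (s c).
Qed.

Lemma mneg_grid_of (s : filling) :
  mneg (grid_of s) = (\sum_(c : cell) (s c).2)%N.
Proof.
rewrite /mneg -sum1_card big_mkcond (@big_grid_of _ _ _ _ _
  (fun o => if (if o is Some (_, true) then true else false)
            then 1 else 0)%N) //.
by apply: eq_bigr => c _; case: (s c) => j [].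
Qed.

Lemma ppos_grid_of (s : filling) :
  ppos (grid_of s) = (\sum_(c : cell) ~~ (s c).2)%N.
Proof.
rewrite /ppos -sum1_card big_mkcond (@big_grid_of _ _ _ _ _
  (fun o => if (if o is Some (_, false) then true else false)
            then 1 else 0)%N) //.
by apply: eq_bigr => c _; case: (s c) => j [].
Qed.

Lemma all_positive_grid_of (s : filling) :
  all_positive (grid_of s) = [forall c, ~~ (s c).2].
Proof.
apply/forallP/forallP => s_pos c.
  by have := s_pos (val c); rewrite grid_of_val; case: (s c) => j [].
have [cd|cd] := boolP (c \in @dg la); last by rewrite grid_of_out.
have := s_pos (exist _ c cd : cell).
rewrite (grid_of_val s (exist _ c cd : cell)).
by case: (s _) => j [].
Qed.

Lemma CmacE :
  Cmac la N = @fill_sum _ _ mcell_wt (ord_alphabet N) (fun j => 'X_j).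
Proof.
pose w (x : letter) : K := if x.2 then 0 else 'X_(x.1).
pose e (j : ord_alphabet N) : letter := (j, false).
transitivity (fill_sum mcell_wt w); last first.
  apply: (@fill_sum_embed _ _ _ (ord_alphabet N) letter e) => //.
    move=> j j'.
    by rewrite /= !addn0 ltn_double.
  by case=> j [] // /negP[]; apply: (codom_f e j).
rewrite /Cmac sum_fillings // big_mkcond; apply: eq_bigr => s _.
rewrite all_positive_grid_of; case: forallP => [s_pos|/forallP].
  rewrite stat_fill_wt // fill_wt_mcell_wt -mul_mpolyC xmon_grid_of.
  rewrite -prod_cells_content; congr (_ * _).
  by apply: eq_bigr => c _; rewrite /w (negPf (s_pos c)).
rewrite negb_forall => /existsP[c]; rewrite negbK => s_neg.
by rewrite (bigD1 c) //= {1}/w s_neg mul0r mulr0.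
Qed.

Lemma Cmac_sym : Cmac la N \is symmetric.
Proof.
apply/issymP => p; rewrite CmacE.
rewrite (fill_sum_rmorph (msym p : {rmorphism K -> K})) /=.
rewrite -[RHS](fill_sum_perm _ p (@reading_index_inj la) mcell_wt_nested).
apply: eq_fill_sum => [v u|j]; first by rewrite /mcell_wt /msym mmapC.
by rewrite /msym mmapX mmap1U.
Qed.

Lemma msupp_sum_content (P : pred filling) (a : filling -> Qqt) m :
  m \in msupp (\sum_(s | P s) a s *: 'X_[content s]) ->
  exists2 s, P s & content s = m.
Proof.
rewrite mcoeff_msupp raddf_sum /= => nz.
have [/existsP[s /andP[Ps /eqP e]]|nex] :=
  boolP [exists s, P s && (content s == m)]; first by exists s.
case/eqP: nz; apply: big1 => s Ps; rewrite mcoeffZ mcoeffX; case: eqP => [e|_].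
  by case/negP: nex; apply/existsP; exists s; rewrite Ps e eqxx.
by rewrite mulr0.
Qed.

Lemma Cmac_homog : Cmac la N \is (sumn la).-homog.
Proof.
rewrite /Cmac sum_fillings //; apply: rpred_sum => s _; apply: rpredZ.
by rewrite xmon_grid_of dhomogX; apply/eqP/mdeg_content.
Qed.

Definition super_var (x : letter) : K :=
  if x.2 then - 'X_(x.1) else tt_ *: 'X_(x.1).

Lemma super_filling_wt (s : filling) :
  ((-1) ^+ mneg (grid_of s) * qq ^+ maj (grid_of s) *
     tt_ ^+ (ppos (grid_of s) + quinv (grid_of s))) *: xmon (grid_of s) =
  fill_wt mcell_wt s * \prod_c super_var (s c).
Proof.
rewrite mneg_grid_of ppos_grid_of exprD fill_wt_mcell_wt -stat_fill_wt //.
rewrite xmon_grid_of -prod_cells_content mul_mpolyC !expr_sum.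
have -> : \prod_c super_var (s c) =
   (\prod_(c : cell) (-1) ^+ (s c).2 * \prod_(c : cell) tt_ ^+ (~~ (s c).2)) *:
     \prod_(c : cell) 'X_((s c).1).
  rewrite -big_split -scaler_prod; apply: eq_bigr => c _; rewrite /super_var.
  by case: (s c).2; rewrite /= ?expr0 ?expr1 ?mulr1 ?mul1r // scaleN1r.
by rewrite scalerA; congr (_ *: _); ring.
Qed.

Definition attacked (s : filling) (u : cell) : bool :=
  [exists v, attacks v u && ((s v).1 == (s u).1)].

Lemma non_attackingP (F : gridT la N) :
  reflect
    (forall i j r r', (i < j)%N -> in_dg la r.+1 i.+1 -> in_dg la r'.+1 j.+1 ->
       r = r' \/ r = r'.+1 ->
       (entry F r.+1 i.+1).1 != (entry F r'.+1 j.+1).1)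
    (non_attacking F).
Proof.
have bounds r i : in_dg la r.+1 i.+1 ->
    (r.+1 < (head 0%N la).+1)%N /\ (i.+1 < (size la).+1)%N.
  by case/(cell_exists pla) => c [<- <-]; rewrite !ltnS ltn_row ltn_col.
apply: (iffP idP) => [na i j r r' ij ri rj rr|na].
  have [[r_lt i_lt] [r'_lt j_lt]] := (bounds _ _ ri, bounds _ _ rj).
  move/forallP: na => /(_ (Ordinal i_lt))/forallP/(_ (Ordinal j_lt)).
  move=> /forallP/(_ (Ordinal r_lt))/forallP/(_ (Ordinal r'_lt))/implyP; apply.
  by rewrite /= ltnS ij ri rj; case: rr => ->; rewrite eqxx ?orbT.
apply/forallP=> -[[|i] ? /=]; first by do 3!apply/forallP => ?.
apply/forallP=> -[[|j] ? /=]; first by do 2!apply/forallP => ?.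
apply/forallP=> -[[|r] ? /=].
  by apply/forallP => ?; rewrite /in_dg /= !andbF.
apply/forallP=> -[[|r'] ? /=]; first by rewrite /in_dg /= !andbF.
apply/implyP => /and4P[ij ri rj rr]; apply: na => //.
by case/orP: rr => /eqP[->]; [left | right].
Qed.

Lemma non_attacking_grid_of (s : filling) :
  non_attacking (grid_of s) = ~~ [exists u, attacked s u].
Proof.
apply/non_attackingP/existsPn => [na u|no_attacked i j r r' ij].
  apply/existsPn => v; apply/negP => /andP[att /eqP eq_abs].
  case/orP: att => /andP[/eqP eq_row lt_col].
    have := na _ _ _ _ lt_col (cellP v) (cellP u) (or_introl eq_row).
    by rewrite !entry_grid_of eq_abs eqxx.
  have := na _ _ _ _ lt_col (cellP u) (cellP v) (or_intror eq_row).
  by rewrite !entry_grid_of eq_abs eqxx.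
move=> /(cell_exists pla)[v [vr vi]] /(cell_exists pla)[u [ur ui]] rr.
rewrite -vr -vi -ur -ui !entry_grid_of eqSS; apply/negP => /eqP/val_inj eq_abs.
have not_attacked w w' : (s w).1 = (s w').1 -> ~~ attacks w w'.
  move=> e; apply: contra (no_attacked w') => att; apply/existsP; exists w.
  by rewrite att e eqxx.
case: rr => rr; [case/negP: (not_attacked v u eq_abs)|
  case/negP: (not_attacked u v (esym eq_abs))].
all: by rewrite /attacks vr ur vi ui rr ij eqxx ?orbT.
Qed.

Section AttackedCancellation.

Definition flip_sign (x : letter) : letter := (x.1, ~~ x.2).

Lemma flip_signK : involutive flip_sign.
Proof. by case=> j b; rewrite /flip_sign negbK. Qed.

Lemma super_gt_flip_signr (x y : letter) :
  super_gt x (flip_sign y) = super_gt x y.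
Proof. by rewrite !super_gt_letterE. Qed.

Lemma attacked_flip (s s' : filling) :
  (forall u, s' u = s u \/ s' u = flip_sign (s u)) -> attacked s' =1 attacked s.
Proof.
move=> ss'; have abs u : (s' u).1 = (s u).1 by case: (ss' u) => ->.
by move=> u; apply: eq_existsb => v; rewrite !abs.
Qed.

Local Notation first_attacked := (first_bad (@reading_index la) attacked).

(* A second attacker would attack the first one, or be attacked by it. *)
Lemma first_attacked_unique (s : filling) (u v0 v : cell) :
  first_attacked s u -> attacks v0 u -> (s v0).1 = (s u).1 ->
  v != v0 -> (s v).1 = (s u).1 -> mcell_wt v u = 1.
Proof.
move=> first_u att0 eq0 neq eq_v; apply/eqP; apply: contraT => wvu.
have lt_vu := mcell_wt_reading_index wvu.
have lt_v0u : (reading_index v0 < reading_index u)%N.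
  by apply: attacks_reading_index; rewrite att0.
have not_attacked w : (reading_index w < reading_index u)%N -> ~~ attacked s w.
  move=> lt_wu; apply: contraL lt_wu => /(first_bad_le first_u).
  by rewrite leqNgt.
have neq_pair w w' :
    (reading_index w' < reading_index u)%N -> (w, w') != (w, u).
  by move=> lt; apply: contraTneq lt => -[->]; rewrite ltnn.
have [lt|gt|/reading_index_inj e] :=
  ltngtP (reading_index v) (reading_index v0).
- case/negP: (not_attacked _ lt_v0u); apply/existsP; exists v.
  rewrite eq0 eq_v eqxx andbT.
  apply: (attacks_nested (mcell_wt_neq1 wvu)) => //; first exact: neq_pair.
  exact: ltnW.
- case/negP: (not_attacked _ lt_vu); apply/existsP; exists v0.
  rewrite eq0 eq_v eqxx andbT.
  by apply: (@attacks_nested _ v0 u); rewrite ?att0 // ?neq_pair // ltnW.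
by rewrite e eqxx in neq.
Qed.

Lemma prod_super_gt_first_attacked (s : filling) (u v0 : cell) (x : letter) :
  first_attacked s u -> attacks v0 u -> (s v0).1 = (s u).1 -> x.1 = (s u).1 ->
  \prod_v (if super_gt x (s v) then mcell_wt v u else 1) =
  (if x.2 then tt_%:MP else 1) *
  \prod_(v | v != v0) (if ((s v).1 < (s u).1)%N then mcell_wt v u else 1).
Proof.
move=> first_u att0 eq0 eq_x; rewrite (bigD1 v0) //=; congr (_ * _).
  by rewrite super_gt_letterE eq_x eq0 ltnn eqxx /= /mcell_wt /cell_wt att0.
apply: eq_bigr => v neq; rewrite super_gt_letterE eq_x; case: ltnP => //= _.
case: eqP => //= /esym eq_v; case: x.2 => //.
exact: first_attacked_unique first_u att0 eq0 neq eq_v.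
Qed.

Lemma attacked_sum_eq0 :
  \sum_(s : filling | [exists u, attacked s u])
     fill_wt mcell_wt s * \prod_c super_var (s c) = 0.
Proof.
apply: (sum_flip_first (@reading_index_inj la) flip_signK attacked_flip).
  exact: mpoly_Qqt_lreg2.
move=> s u first_u; rewrite /fill_wt -!big_split /=.
have [/existsP[v0 /andP[att0 /eqP eq0]] _] := andP first_u.
rewrite (bigD1 u) // [in RHS](bigD1 u) //= -mulNr; congr (_ * _); last first.
  apply: eq_bigr => w /negPf neq; rewrite ffunE neq; congr (_ * _).
  apply: eq_bigr => v _; rewrite ffunE.
  by case: (v == u); rewrite ?super_gt_flip_signr.
have -> : \prod_v (if super_gt (flip_at flip_sign u s u)
                               (flip_at flip_sign u s v)
                   then mcell_wt v u else 1) =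
    \prod_v (if super_gt (flip_sign (s u)) (s v) then mcell_wt v u else 1).
  apply: eq_bigr => v _; rewrite !ffunE eqxx.
  by case: (v == u); rewrite ?super_gt_flip_signr.
rewrite !(prod_super_gt_first_attacked first_u att0 eq0) // ffunE eqxx.
rewrite /super_var /=.
by case: (s u).2; rewrite /= -!mul_mpolyC; ring.
Qed.

End AttackedCancellation.

Lemma CsuperE : Csuper la N = fill_sum mcell_wt super_var.
Proof.
rewrite /Csuper sum_fillings // /fill_sum.
rewrite [RHS](bigID (fun s : filling => [exists u, attacked s u])) /=.
rewrite attacked_sum_eq0 add0r.
by apply: eq_big => s; rewrite ?non_attacking_grid_of // super_filling_wt.
Qed.

End MacdonaldSums.

(** * Superization of the Macdonald sums *)

Section Plethysm.
Variables (la : seq nat) (N : nat).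
Hypotheses (pla : is_partition la) (le_N : (sumn la <= N)%N).
Local Notation K := {mpoly Qqt[N]}.

Definition mpoly_coeffs (s : seq (Qqt * seq nat)) : seq (K * seq nat) :=
  [seq (x.1%:MP, x.2) | x <- s].

Lemma super_psum_comb_expansion s f (w : ord_alphabet N -> K) :
  psum_expansion (sumn la) s f ->
  f \mPo [tuple w i | i < N] = super_psum_comb (mpoly_coeffs s) w.
Proof.
case=> _ ->; rewrite /super_psum_comb big_map rmorph_sum.
apply: eq_bigr => x _ /=.
rewrite comp_mpolyZ -mul_mpolyC rmorph_prod; congr (_ * _).
apply: eq_bigr => m _; rewrite rmorph_sum; apply: eq_bigr => i _ /=.
by rewrite rmorphXn /= comp_mpolyXU -tnth_nth tnth_mktuple.
Qed.

Lemma Cmac_subst (w : ord_alphabet N -> K) :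
  Cmac la N \mPo [tuple w i | i < N] = fill_sum (@mcell_wt la N) w.
Proof.
rewrite CmacE //.
rewrite (fill_sum_rmorph (comp_mpoly [tuple w i | i < N] : {rmorphism K -> K})).
apply: eq_fill_sum => [v u|j] /=; first exact: comp_mpolyC.
by rewrite comp_mpolyXU -tnth_nth tnth_mktuple.
Qed.

Lemma super_psum_super_var m :
  super_psum (@super_var N) m = (tt_ ^+ m - 1)%:MP * psum N m.
Proof.
rewrite /super_psum (eq_bigr (fun x => if x.2 then - 'X_(x.1) ^+ m
    else (tt_ ^+ m) *: 'X_(x.1) ^+ m)); last first.
  by case=> j [] _; rewrite /super_var /= ?opprK // exprZn.
rewrite -(pair_bigA _ (fun j (b : bool) =>
  if b then - 'X_j ^+ m else (tt_ ^+ m) *: 'X_j ^+ m)) /=.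
rewrite mulr_sumr; apply: eq_bigr => j _.
by rewrite big_bool /= mpolyCB mpolyC1 mulrBl mul1r mul_mpolyC addrC.
Qed.

Lemma pleth_tm1E s :
  pleth_tm1 N s = super_psum_comb (mpoly_coeffs s) (@super_var N).
Proof.
rewrite /super_psum_comb big_map; apply: eq_bigr => x _ /=.
rewrite -mul_mpolyC mpolyCM -mulrA rmorph_prod -big_split; congr (_ * _).
by apply: eq_bigr => m _; rewrite super_psum_super_var.
Qed.

Lemma is_partition_of_size d mu : is_partition_of d mu -> (size mu <= d)%N.
Proof.
case/andP=> /andP[_ mu_pos] /eqP <-; elim: mu mu_pos => //= m mu IHmu.
by case/andP=> m_gt0 /IHmu le_mu; rewrite -add1n leq_add.
Qed.

Lemma pleth_tm1_Csuper s : psum_expansion (sumn la) s (Cmac la N) ->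
  pleth_tm1 N s = Csuper la N.
Proof.
move=> exp_s; have /allP s_part := proj1 exp_s.
have reg2 := @mpoly_Qqt_lreg2 N; rewrite CsuperE // pleth_tm1E; apply/esym.
apply: (supersymmetric_eq (d := #|cell la|)).
- apply: fill_sum_supersymmetric reg2 (@reading_index_inj la) _.
  exact: mcell_wt_reading_index.
- apply: super_psum_comb_supersymmetric => //.
    rewrite all_map; apply/allP => x /s_part.
    by rewrite /= card_cell //; apply: is_partition_of_size.
  rewrite all_map; apply/allP => x /s_part.
  by case/andP=> /andP[].
- by rewrite card_cell; first exact: le_N.
by move=> w; rewrite -Cmac_subst (super_psum_comb_expansion _ exp_s).
Qed.

End Plethysm.

(** * Dominance *)

Lemma card_ord_lt k n : (n <= k)%N -> #|[set j : 'I_k | (j < n)%N]| = n.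
Proof.
move=> le_nk; rewrite cardsE -sum1_card.
by rewrite -(big_ord_widen k (fun=> 1%N)) // sum1_card card_ord.
Qed.

Section Dominance.
Variables (la : seq nat) (N : nat).
Hypothesis pla : is_partition la.
Local Notation H := (head 0%N la).

Definition row_length (r : nat) : nat := find (geq r) la.

Lemma row_length_le r : (row_length r <= size la)%N.
Proof. exact: find_size. Qed.

Lemma ltn_nth_row_length r j : (r < nth 0%N la j)%N = (j < row_length r)%N.
Proof.
rewrite ltnNge; case: ltnP => [/(before_find 0%N)/= -> //|le_j].
apply/negbF; apply: leq_trans (partition_nth_le pla le_j) _.
have [has_r|no_r] := boolP (has (geq r) la); first exact: (nth_find 0%N has_r).
by rewrite nth_default // leqNgt -has_find.
Qed.

Lemma sumn_take_row_length i :
  sumn (take i la) = (\sum_(r < H) minn i (row_length r))%N.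
Proof.
have -> : sumn (take i la) = (\sum_(j < size la | (j < i)%N) nth 0%N la j)%N.
  elim: (la) i => [|x r IHr] [|i] /=; rewrite ?big_ord0 //.
    by rewrite big_pred0.
  by rewrite big_mkcond big_ord_recl /= -big_mkcond IHr.
under eq_bigr do
  rewrite -[nth _ _ _](@card_ord_lt H) ?partition_nth_le_head // -sum1_card.
rewrite (exchange_big_dep xpredT) //=; apply: eq_bigr => r _.
rewrite -[RHS](@card_ord_lt (size la)) ?geq_min ?row_length_le ?orbT //.
rewrite -sum1_card; apply: eq_bigl => j.
by rewrite !inE ltn_nth_row_length leq_min.
Qed.

Section Rows.
Variables (s : {ffun cell la -> letter_alphabet N}) (J : {set 'I_N}) (i : nat).
Hypotheses (s_na : non_attacking (grid_of s)) (le_J : (#|J| <= i)%N).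

Lemma non_attacking_row_inj (v u : cell la) :
  row v = row u -> (s v).1 = (s u).1 -> v = u.
Proof.
have separated (a b : cell la) :
    row a = row b -> (s a).1 = (s b).1 -> ~ (col a < col b)%N.
  move=> eq_row eq_abs lt_col; move: s_na; rewrite non_attacking_grid_of //.
  move=> /existsPn/(_ b)/existsP[]; exists a.
  by rewrite /attacks eq_row lt_col eq_abs !eqxx.
move=> eq_row eq_abs; apply: cell_inj => //.
case: (ltngtP (col v) (col u)) => // lt_col.
  by case: (separated v u eq_row eq_abs lt_col).
by case: (separated u v (esym eq_row) (esym eq_abs) lt_col).
Qed.

Lemma non_attacking_row_count r :
  (#|[set c : cell la | (row c == r) && ((s c).1 \in J)]|
     <= minn i (row_length r))%N.
Proof.
rewrite leq_min; set A := [set c | _]; apply/andP; split.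
  have abs_inj : {in A &, injective (fun c => (s c).1)}.
    move=> v u; rewrite !inE => /andP[/eqP vr _] /andP[/eqP ur _].
    by apply: non_attacking_row_inj; rewrite vr ur.
  rewrite -(card_in_imset abs_inj); apply: leq_trans le_J.
  apply/subset_leq_card/subsetP => x /imsetP[c].
  by rewrite inE => /andP[_ cJ] ->.
have col_inj : {in A &, injective (fun c : cell la => (val c).2)}.
  move=> v u; rewrite !inE => /andP[/eqP vr _] /andP[/eqP ur _] eq_col.
  by apply: cell_inj; rewrite ?vr ?ur // /col eq_col.
rewrite -(card_in_imset col_inj) -(card_ord_lt (row_length_le r)).
apply/subset_leq_card/subsetP => j /imsetP[c].
rewrite !inE => /andP[/eqP cr _] ->; rewrite -ltn_nth_row_length -cr.
by have := cellP c; rewrite in_dgE => /andP[].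
Qed.

Lemma non_attacking_count :
  (#|[set c : cell la | (s c).1 \in J]| <= sumn (take i la))%N.
Proof.
rewrite sumn_take_row_length -sum1_card.
rewrite (partition_big (fun c : cell la => (val c).1) xpredT) //=.
apply: leq_sum => r _; rewrite sum1_card.
apply: leq_trans (non_attacking_row_count r).
by apply/subset_leq_card/subsetP => c; rewrite unfold_in !inE -val_eqE andbC.
Qed.

End Rows.

Lemma Csuper_dominated m : m \in msupp (Csuper la N) ->
  mdeg m = sumn la /\ dominated (mpart m) la.
Proof.
rewrite /Csuper sum_fillings //; under eq_bigr do rewrite xmon_grid_of.
move=> /(@msupp_sum_content la N (fun s => non_attacking (grid_of s)) _ m).
case=> s s_na <-; rewrite /dominated sumn_mpart mdeg_content // eqxx andTb.
split=> //.
apply/allP => i _; have [J le_J ->] := sumn_take_mpart (content s) i.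
apply: leq_trans (non_attacking_count s_na le_J).
rewrite -sum1_card (partition_big (fun c => (s c).1) (mem J)) /= => [|c].
  apply: leq_sum => j jJ; rewrite contentE -sum1_card.
  apply/eq_leq/eq_bigl => c.
  by rewrite !inE; apply/esym; apply: andb_idl => /eqP ->.
by rewrite inE.
Qed.

End Dominance.

(* N >= |la| variables represent symmetric functions of degree |la|
   faithfully. *)
Theorem mainTheorem5 (la : seq nat) (N : nat) :
  is_partition la -> (sumn la <= N)%N ->
  (exists s, psum_expansion (sumn la) s (Cmac la N)) /\
  (forall s, psum_expansion (sumn la) s (Cmac la N) ->
     pleth_tm1 N s = Csuper la N) /\
  (exists c : seq (Qqt * seq nat),
     all (fun x => is_partition_of (sumn la) x.2 && dominated x.2 la) c /\
     forall s, psum_expansion (sumn la) s (Cmac la N) ->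
       pleth_tm1 N s = \sum_(x <- c) x.1 *: msym_part N x.2).
Proof.
move=> pla le_N.
have plethE s := @pleth_tm1_Csuper la N pla le_N s.
have [s0 exp_s0] := sym_psum_spanned (Cmac_sym N pla) (Cmac_homog N pla).
have Csuper_sym : Csuper la N \is symmetric.
  by rewrite -(plethE s0) ?sym_pleth_tm1.
have [c [c_supp expansion]] := sym_msym_part_expansion Csuper_sym.
split; first by exists s0.
split=> //; exists c; split=> [|s /plethE -> //].
apply/allP => x /c_supp[m /(Csuper_dominated pla)[<- dom_m] ->].
by rewrite is_partition_mpart.
Qed.
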